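(* Let $f(n)=|[n]^n(123)|$ for $n\ge0$. The generating function $\sum_{n\ge0}f(n)z^n$ is transcendental (that is, not algebraic over the field of rational functions in $z$).
   Context: $[n]^n$ is the set of words of length $n$ with letters in $[n]=\{1,\dots,n\}$ (for $n=0$ it consists of the empty word). A word $w=w_1\cdots w_n$ avoids $123$ if there are no indices $a<b<c$ with $w_a<w_b<w_c$; $[n]^n(123)$ is the set of words in $[n]^n$ avoiding $123$. *)

(* Defs.v *)
From HB Require Import structures.
From mathcomp Require Import all_boot all_order all_algebra.
From mathcomp Require Import boolp.

Set Implicit Arguments.
Unset Strict Implicit.
Unset Printing Implicit Defensive.

Import GRing.Theory.
Local Open Scope ring_scope.

(* A word over [n] is a tuple over 'I_n = {0, ..., n-1}; the shift of the     *)
(* alphabet by one is immaterial, as pattern avoidance only compares letters. *)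
Definition contains123 (k n : nat) (w : n.-tuple 'I_k) : bool :=
  [exists a : 'I_n, exists b : 'I_n, exists c : 'I_n,
    [&& a < b, b < c, tnth w a < tnth w b & tnth w b < tnth w c]%N].

Definition words123 (n : nat) : {set n.-tuple 'I_n} :=
  [set w | ~~ contains123 w].

Record fps (K : fieldType) := Fps { fps_coef :> nat -> K }.

Section FpsRing.
Variable K : fieldType.
Implicit Types (f g h : fps K) (p q : {poly K}).

HB.instance Definition _ := gen_eqMixin (fps K).
HB.instance Definition _ := gen_choiceMixin (fps K).

Lemma fpsP f g : (forall n, f n = g n) -> f = g.
Proof. by case: f g => [f] [g] /= /funext ->. Qed.

Definition fps_zero : fps K := Fps (fun=> 0).
Definition fps_one : fps K := Fps (fun n => (n == 0%N)%:R).
Definition fps_opp f : fps K := Fps (fun n => - f n).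
Definition fps_add f g : fps K := Fps (fun n => f n + g n).
Definition fps_mul f g : fps K :=
  Fps (fun n => \sum_(i < n.+1) f i * g (n - i)%N).

Fact fps_addA : associative fps_add.
Proof. by move=> f g h; apply: fpsP => n /=; rewrite addrA. Qed.
Fact fps_addC : commutative fps_add.
Proof. by move=> f g; apply: fpsP => n /=; rewrite addrC. Qed.
Fact fps_add0 : left_id fps_zero fps_add.
Proof. by move=> f; apply: fpsP => n /=; rewrite add0r. Qed.
Fact fps_addN : left_inverse fps_zero fps_opp fps_add.
Proof. by move=> f; apply: fpsP => n /=; rewrite addNr. Qed.

HB.instance Definition _ :=
  GRing.isZmodule.Build (fps K) fps_addA fps_addC fps_add0 fps_addN.

Definition fps_trunc (m : nat) f : {poly K} := \poly_(i < m) f i.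

Lemma coef_fps_trunc m f i : (i < m)%N -> (fps_trunc m f)`_i = f i.
Proof. by move=> lt_im; rewrite coef_poly lt_im. Qed.

Lemma fps_mul_trunc m f g n :
  (n < m)%N -> fps_mul f g n = (fps_trunc m f * fps_trunc m g)`_n.
Proof.
move=> lt_nm; rewrite coefM /=; apply: eq_bigr => i _.
rewrite !coef_fps_trunc // ?(leq_ltn_trans (leq_subr _ _)) //.
by apply: leq_trans lt_nm; apply: ltn_ord.
Qed.

Fact fps_mulA : associative fps_mul.
Proof.
move=> f g h; apply: fpsP => n.
pose t := fps_trunc n.+1.
have -> : fps_mul f (fps_mul g h) n = (t f * (t g * t h))`_n.
  rewrite coefM /=; apply: eq_bigr => i _.
  rewrite coef_fps_trunc // -[\sum_(_ < _) _]/(fps_mul g h (n - i)%N).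
  by rewrite (@fps_mul_trunc n.+1) // ltnS leq_subr.
rewrite mulrA coefM /=; apply: eq_bigr => i _.
rewrite -[\sum_(_ < _) _]/(fps_mul f g i) (@fps_mul_trunc n.+1) //.
by rewrite coef_fps_trunc // ltnS leq_subr.
Qed.

Fact fps_mulC : commutative fps_mul.
Proof.
move=> f g; apply: fpsP => n.
by rewrite !(@fps_mul_trunc n.+1) // mulrC.
Qed.

Fact fps_mul1 : left_id fps_one fps_mul.
Proof.
move=> f; apply: fpsP => n /=.
rewrite big_ord_recl /= mul1r subn0 big1 ?addr0 // => i _.
by rewrite mul0r.
Qed.

Fact fps_mulDl : left_distributive fps_mul fps_add.
Proof.
move=> f g h; apply: fpsP => n /=.
by rewrite -big_split /=; apply: eq_bigr => i _; rewrite mulrDl.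
Qed.

Fact fps_one_neq0 : fps_one != 0.
Proof.
apply/eqP => /(congr1 (fun f : fps K => f 0%N)) /= /eqP.
by rewrite oner_eq0.
Qed.

HB.instance Definition _ := GRing.Zmodule_isComNzRing.Build (fps K)
  fps_mulA fps_mulC fps_mul1 fps_mulDl fps_one_neq0.

Definition fps_unit : pred (fps K) := fun f => `[< exists g, g * f = 1 >].
Definition fps_inv f : fps K :=
  if pselect (exists g, g * f = 1) is left ex_g then sval (cid ex_g) else f.

Fact fps_mulVr : {in fps_unit, left_inverse 1 fps_inv *%R}.
Proof.
move=> f /asboolP ex_g; rewrite /fps_inv.
by case: pselect => // ?; case: cid.
Qed.
Fact fps_unitP f g : g * f = 1 -> fps_unit f.
Proof. by move=> gf1; apply/asboolP; exists g. Qed.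
Fact fps_inv_out : {in [predC fps_unit], fps_inv =1 id}.
Proof.
by move=> f /asboolP nex_g; rewrite /fps_inv; case: pselect.
Qed.

HB.instance Definition _ := GRing.ComNzRing_hasMulInverse.Build (fps K)
  fps_mulVr fps_unitP fps_inv_out.

Lemma fps_neq0_order f :
  f != 0 -> exists m, f m != 0 /\ forall i, (i < m)%N -> f i = 0.
Proof.
move=> f_neq0.
have ex_m : exists m, f m != 0.
  apply: contrapT => nex; case/eqP: f_neq0; apply: fpsP => n.
  by apply/eqP; apply: contrapT => /negP fn; apply: nex; exists n.
case: (ex_minnP ex_m) => m fm min_m; exists m; split=> // i lt_im.
by apply/eqP; apply: contraTT lt_im => /min_m; rewrite -leqNgt.
Qed.

Fact fps_integral f g : f * g = 0 -> (f == 0) || (g == 0).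
Proof.
move=> fg0; apply: contrapT => /negP; rewrite negb_or => /andP[].
move=> /fps_neq0_order[m [fm f0]] /fps_neq0_order[k [gk g0]].
have : (f * g) (m + k)%N = f m * g k.
  rewrite /=.
  have lt_m : (m < (m + k).+1)%N by rewrite ltnS leq_addr.
  rewrite (bigD1 (Ordinal lt_m)) //= addKn big1 ?addr0 // => i.
  rewrite -val_eqE /= neq_ltn => /orP[/f0->|lt_mi]; first by rewrite mul0r.
  rewrite (g0 (m + k - i)%N) ?mulr0 // ltn_subLR ?ltn_add2r //.
  by rewrite -ltnS.
by rewrite fg0 => /esym/eqP; rewrite mulf_eq0 (negPf fm) (negPf gk).
Qed.

HB.instance Definition _ :=
  GRing.ComUnitRing_isIntegral.Build (fps K) fps_integral.

Definition poly_fps p : fps K := Fps (fun n => p`_n).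

Fact poly_fps_is_zmod_morphism : zmod_morphism poly_fps.
Proof. by move=> p q; apply: fpsP => n /=; rewrite coefB. Qed.
Fact poly_fps_is_monoid_morphism : monoid_morphism poly_fps.
Proof.
by split=> [|p q]; apply: fpsP => n /=; rewrite ?coef1 ?coefM.
Qed.
HB.instance Definition _ := GRing.isZmodMorphism.Build {poly K} (fps K)
  poly_fps poly_fps_is_zmod_morphism.
HB.instance Definition _ := GRing.isMonoidMorphism.Build {poly K} (fps K)
  poly_fps poly_fps_is_monoid_morphism.

Lemma poly_fps_inj : injective poly_fps.
Proof.
by move=> p q [eq_pq]; apply/polyP => n; rewrite [LHS](congr1 (@^~ n) eq_pq).
Qed.

End FpsRing.

Definition ratfun (K : fieldType) := {fraction {poly K}}.

(* The field of formal Laurent series, as the fraction field of K[[z]]. *)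
Definition laurent (K : fieldType) := {fraction (fps K)}.

HB.instance Definition _ (K : fieldType) := GRing.Field.on (ratfun K).
HB.instance Definition _ (K : fieldType) := GRing.Field.on (laurent K).

Definition fps_laurent (K : fieldType) (f : fps K) : laurent K :=
  FracField.tofrac f.

(* The canonical embedding K(z) -> K((z)), extending K[z] -> K[[z]]; it does  *)
(* not depend on the representative, see ratfun_laurentE.                     *)
Definition ratfun_laurent (K : fieldType) (x : ratfun K) : laurent K :=
  fps_laurent (poly_fps \n_(repr x)) / fps_laurent (poly_fps \d_(repr x)).

Section RatfunLaurent.
Variable K : fieldType.
Implicit Types (p q : {poly K}) (x y : ratfun K).

HB.instance Definition _ := GRing.RMorphism.copy (@fps_laurent K)
  (@FracField.tofrac (fps K)).

Lemma fps_laurent_eq0 (f : fps K) : (fps_laurent f == 0) = (f == 0).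
Proof. exact: tofrac_eq0. Qed.

Lemma poly_laurent_neq0 q : q != 0 -> fps_laurent (poly_fps q) != 0.
Proof.
by rewrite fps_laurent_eq0 -(rmorph0 (@poly_fps K)) (inj_eq (@poly_fps_inj K)).
Qed.

Lemma ratfun_numden x :
  x = FracField.tofrac \n_(repr x) / FracField.tofrac \d_(repr x) :> {fraction _}.
Proof.
have d_neq0 : FracField.tofrac \d_(repr x) != 0 :> {fraction {poly K}}.
  by rewrite tofrac_eq0 denom_ratioP.
apply: (canRL (mulfK d_neq0)); unlock FracField.tofrac.
rewrite -{1}[x]reprK -[LHS]FracField.pi_mul; apply/eqmodP.
rewrite /= FracField.equivfE !numden_Ratio ?mulf_neq0 ?denom_ratioP ?oner_neq0 //.
by rewrite !mulr1 mulrC.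
Qed.

Lemma ratfun_laurentE p q : q != 0 ->
  ratfun_laurent (FracField.tofrac p / FracField.tofrac q)
    = fps_laurent (poly_fps p) / fps_laurent (poly_fps q).
Proof.
move=> q_neq0; set x := FracField.tofrac p / _.
have d_neq0 := denom_ratioP (repr x).
apply/eqP; rewrite /ratfun_laurent eqr_div ?poly_laurent_neq0 //.
have /eqP := ratfun_numden x.
rewrite {1}/x eqr_div ?tofrac_eq0 // -!tofracM tofrac_eq => /eqP eq_pq.
by rewrite -!rmorphM /= eq_pq.
Qed.

Fact ratfun_laurent_is_zmod_morphism : zmod_morphism (@ratfun_laurent K).
Proof.
move=> x y; rewrite {1}[x]ratfun_numden {1}[y]ratfun_numden.
have dx := denom_ratioP (repr x); have dy := denom_ratioP (repr y).
rewrite -mulNr addf_div ?tofrac_eq0 // -tofracN -!tofracM -tofracD.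
rewrite ratfun_laurentE ?mulf_neq0 // /ratfun_laurent -mulNr.
by rewrite addf_div ?poly_laurent_neq0 // !(rmorphD, rmorphM, rmorphN).
Qed.

Fact ratfun_laurent_is_monoid_morphism : monoid_morphism (@ratfun_laurent K).
Proof.
split=> [|x y].
  have -> : 1 = FracField.tofrac 1 / FracField.tofrac 1 :> ratfun K.
    by rewrite !tofrac1 divr1.
  by rewrite ratfun_laurentE ?oner_neq0 // !rmorph1 divr1.
rewrite {1}[x]ratfun_numden {1}[y]ratfun_numden.
rewrite mulf_div -!tofracM ratfun_laurentE ?mulf_neq0 ?denom_ratioP //.
by rewrite /ratfun_laurent mulf_div !rmorphM.
Qed.

HB.instance Definition _ := GRing.isZmodMorphism.Build (ratfun K) (laurent K)
  (@ratfun_laurent K) ratfun_laurent_is_zmod_morphism.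
HB.instance Definition _ := GRing.isMonoidMorphism.Build (ratfun K) (laurent K)
  (@ratfun_laurent K) ratfun_laurent_is_monoid_morphism.

End RatfunLaurent.

Definition genfun (K : fieldType) (f : nat -> nat) : fps K :=
  Fps (fun n => (f n)%:R).

Definition transcendental_fps (K : fieldType) (F : fps K) : Prop :=
  ~ algebraicOver (@ratfun_laurent K) (fps_laurent F).

(* Main.v *)
From HB Require Import structures.
Require Import Defs.
From mathcomp Require Import all_boot all_order all_algebra finfield.
From mathcomp Require Import zify ring.
Set Implicit Arguments.
Unset Strict Implicit.
Unset Printing Implicit Defensive.
Import GRing.Theory Num.Theory.

(** Let f(n) be the number of words and F its generating function.

    Counting.  In a word avoiding 123, everything before a copy of the largest
    letter is weakly decreasing.  Removing the first copy of the largest letter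
    therefore gives a recurrence for the number of words with a given alphabet
    size, length and maximal weakly decreasing prefix ([exact_count_rec]).  Its
    solution by ballot numbers yields ([card_words123E])
      f(n) = sum_j Cat_j * [x^n] (x (1 - x))^j * C(n + j - 1, j).

    A companion series.  Put t(n, j) = [x^n] (x (1 - x))^j * C(2 j, j) * C(n + j, j),
    b(n) = sum_j t(n, j) and B = sum_n b(n) z^n.  Creative telescoping shows two
    things: the polynomial multiple g(n) = 6 n (n - 1) (3 n + 1) f(n) is a sum of
    the t(n, j) weighted by a polynomial in n and j ([count123_bterm]), and B
    satisfies ([bseq_rec]) the self-adjoint equation
      (P2 B')' + P0 B = 0,  P2 = z (1 - z) (2 - 27 z),  P0 = 24 z - 8.
    This B is a period of a family of elliptic curves, and its logarithmic
    singularities are the reason for the transcendence; the argument below detects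
    them modulo primes.

    Reduction modulo p.  By Lucas' theorem t(n, j) is multiplicative in the base p
    digits of n and j ([bterm_lucas]).  Hence over F_p
      B = A B^p  and  G = A1 B^p,  with G = sum_n g(n) z^n,
    where A and A1 are the truncations of B and G to degrees below p, and so
    A^p G^(p-1) = A1^(p-1).

    The contradiction.  If F is algebraic then so is G, as it is obtained from F by
    the derivation z d/dz ([algebraic_theta]).  A polynomial relation for G of degree
    less than d in G forces, for every prime p, a relation of degree less than d
    modulo p: the minors of an integer matrix that vanish in characteristic 0 also
    vanish modulo p ([transfer_modp]).  Take p large.  Since F_p contains the roots of
    unity of order p - 1, Kummer theory makes some G^e with 0 < e < d a rational
    function ([kummer]), and then A^e is the (p-1)-st power of a polynomial.  So every
    irreducible factor of A is multiple, with multiplicity below p.  But A inherits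
    the differential equation, whose exponents at every finite point are 0, 1 or 0, 0,
    so it has no such factor ([ode_no_root_power]); and A is not constant. *)

(** * Words avoiding 123 *)

(** This recursive form of 123-avoidance is compatible with concatenation, so that
    inserting a letter can be analysed by induction. *)
Fixpoint avoids (s : seq nat) : bool :=
  if s is a :: s' then pairwise geq [seq x <- s' | a < x] && avoids s' else true.

Lemma pairwise_filter_imply (T : Type) (r : rel T) (P : pred T) s :
  pairwise r [seq x <- s | P x] = pairwise (fun x y => P x && P y ==> r x y) s.
Proof.
elim: s => //= x s <-; case: (P x) => //=; last by rewrite all_predT.
by congr (_ && _); rewrite all_filter.
Qed.

Lemma avoidsP (s : seq nat) :
  reflect (forall a b c, a < b < c -> c < size s ->
            ~~ ((nth 0 s a < nth 0 s b) && (nth 0 s b < nth 0 s c)))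
          (avoids s).
Proof.
elim: s => [|x s IHs] /=; first by apply: ReflectT.
rewrite pairwise_filter_imply.
apply: (iffP andP) => [[/(pairwiseP 0) dec /IHs av] a [|b] [|c] lt_abc lt_c | av];
  try lia.
  case: a lt_abc => [|a] lt_abc /=; last by apply: av; lia.
  have lt_bc : b < c by lia.
  have := dec b c; rewrite !inE /= /geq /= => /(_ _ _ lt_bc) H.
  by have := H ltac:(lia) ltac:(lia); lia.
split.
  apply/(pairwiseP 0) => i j; rewrite !inE /geq /= => lt_i lt_j lt_ij.
  by have := av 0 i.+1 j.+1 ltac:(lia) ltac:(lia); rewrite /=; lia.
by apply/IHs => a b c lt lt_c; apply: (av a.+1 b.+1 c.+1); lia.
Qed.

Lemma contains123E (k n : nat) (w : n.-tuple 'I_k) :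
  ~~ contains123 w = avoids (map val w).
Proof.
have sz : size (map val w) = n by rewrite size_map size_tuple.
have nthE (i : 'I_n) : nth 0 (map val w) i = tnth w i.
  by rewrite -(tnth_nth 0 (map_tuple val w)) tnth_map.
apply/idP/avoidsP => [/existsPn nc a b c /andP[lt_ab lt_bc]| av].
  rewrite sz => lt_c.
  have lt_b := ltn_trans lt_bc lt_c; have lt_a := ltn_trans lt_ab lt_b.
  move: (nc (Ordinal lt_a)) => /existsPn /(_ (Ordinal lt_b)).
  move=> /existsPn /(_ (Ordinal lt_c)) /=.
  rewrite lt_ab lt_bc /= -!nthE //.
apply/existsPn => a; apply/existsPn => b; apply/existsPn => c.
apply/negP => /and4P[lt_ab lt_bc wab wbc].
have := av a b c; rewrite lt_ab lt_bc sz ltn_ord => /(_ isT isT).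
by rewrite !nthE wab wbc.
Qed.

Section CountWords.
Variable M : nat.

(** Words are handled as sequences of natural numbers below a fixed M: deleting a
    letter and shrinking the alphabet then need no change of type. *)
Definition word_seqs (n : nat) : seq (seq nat) :=
  [seq map val (tval w) | w <- enum {: n.-tuple 'I_M}].

Lemma word_seqs_uniq n : uniq (word_seqs n).
Proof.
rewrite map_inj_uniq ?enum_uniq // => u v /inj_map /= H.
by apply: val_inj; apply: H; apply: val_inj.
Qed.

Lemma mem_word_seqs n s :
  (s \in word_seqs n) = (size s == n) && all (fun x => x < M) s.
Proof.
apply/mapP/andP => [[w _ ->]|[/eqP sz_s /allP ltM]].
  rewrite size_map size_tuple eqxx; split=> //.
  by apply/allP => _ /mapP[i _ ->]; apply: ltn_ord.
have [t def_t] : exists t : seq 'I_M, map val t = s.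
  elim: s ltM {sz_s} => [|x s IHs] ltM; first by exists [::].
  have [|t <-] := IHs; first by move=> y sy; apply: ltM; rewrite inE sy orbT.
  by exists (Ordinal (ltM x (mem_head x s)) :: t).
have sz_t : size t == n by rewrite -sz_s -def_t size_map.
by exists (Tuple sz_t); rewrite ?mem_enum.
Qed.

Definition cnt n (P : pred (seq nat)) : nat := count P (word_seqs n).

Lemma eq_cnt n (P Q : pred (seq nat)) :
  (forall s, size s = n -> all (fun x => x < M) s -> P s = Q s) ->
  cnt n P = cnt n Q.
Proof.
move=> eqPQ; apply: eq_in_count => s.
by rewrite mem_word_seqs => /andP[/eqP sz_s ltM]; apply: eqPQ.
Qed.

Lemma cntID n (Q P : pred (seq nat)) :
  cnt n P = cnt n (fun s => P s && Q s) + cnt n (fun s => P s && ~~ Q s).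
Proof.
by rewrite /cnt; elim: (word_seqs n) => //= s r ->; case: (P s); case: (Q s); lia.
Qed.

Lemma cnt_bij n m (P Q : pred (seq nat)) (f g : seq nat -> seq nat) :
  (forall s, size s = n -> all (fun x => x < M) s -> P s ->
     [/\ size (f s) = m, all (fun x => x < M) (f s), Q (f s) & g (f s) = s]) ->
  (forall s, size s = m -> all (fun x => x < M) s -> Q s ->
     [/\ size (g s) = n, all (fun x => x < M) (g s), P (g s) & f (g s) = s]) ->
  cnt n P = cnt m Q.
Proof.
move=> fP gP; rewrite /cnt -!size_filter -(size_map f); apply/perm_size.
have memE k (R : pred (seq nat)) s : (s \in [seq t <- word_seqs k | R t])
    = [&& R s, size s == k & all (fun x => x < M) s].
  by rewrite mem_filter mem_word_seqs.
apply: uniq_perm; rewrite ?filter_uniq ?word_seqs_uniq //.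
  rewrite map_inj_in_uniq ?filter_uniq ?word_seqs_uniq // => s t.
  rewrite !memE => /and3P[Ps /eqP ss ls] /and3P[Pt /eqP st lt] eq_f.
  by case: (fP s ss ls Ps) => _ _ _ <-; rewrite eq_f; case: (fP t st lt Pt).
move=> s; apply/mapP/idP => [[t + ->]|].
  rewrite !memE => /and3P[Pt /eqP st lt].
  by case: (fP t st lt Pt) => -> -> ->; rewrite eqxx.
rewrite memE => /and3P[Qs /eqP ss ls]; case: (gP s ss ls Qs) => sg lg Pg fg.
by exists (g s); rewrite ?fg // memE sg lg Pg eqxx.
Qed.

End CountWords.

Lemma card_words123 n : #|words123 n| = cnt n n avoids.
Proof.
rewrite /cnt count_map cardE {1}/enum_mem -enumT size_filter; apply: eq_count => w.
by rewrite /= inE contains123E.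
Qed.

Definition desc_prefix (l : nat) (s : seq nat) : bool :=
  (l <= size s) && pairwise geq (take l s).

Definition letters_lt (k : nat) (s : seq nat) : bool := all (fun x => x < k) s.

Lemma desc_prefix_le l m s : l <= m -> desc_prefix m s -> desc_prefix l s.
Proof.
move=> le_lm /andP[le_m dec]; rewrite /desc_prefix (leq_trans le_lm le_m) /=.
rewrite -(take_takel _ le_lm).
by apply: subseq_pairwise dec; apply: take_subseq.
Qed.

(** The largest letter can only be the 3 of a pattern 123, and here nothing before it
    provides an ascent. *)
Lemma avoids_insert_max K s1 s2 :
    letters_lt K.+1 s1 -> letters_lt K.+1 s2 -> pairwise geq s1 ->
  avoids (s1 ++ K :: s2) = avoids (s1 ++ s2).
Proof.
elim: s1 => [_ le_s2 _|a s1 IHs] /=.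
  rewrite (@eq_in_filter _ _ pred0) ?filter_pred0 // => x /(allP le_s2) /=.
  by rewrite ltnS => /leq_gtF.
case/andP=> le_a le_s1 le_s2 /andP[ge_a dec]; rewrite IHs //; congr (_ && _).
rewrite !filter_cat (@eq_in_filter _ _ pred0 s1) ?filter_pred0 /=; last first.
  by move=> x /(allP ge_a) /=; rewrite /geq /= => /leq_gtF.
case: (a < K) => //=; rewrite all_filter (_ : all _ _ = true) //.
by apply/allP => x /(allP le_s2) /=; rewrite ltnS /geq => ?; apply/implyP.
Qed.

(** An ascent below K followed by K would be a pattern 123. *)
Lemma avoids_before_max K s1 s2 :
  letters_lt K s1 -> avoids (s1 ++ K :: s2) -> pairwise geq s1.
Proof.
elim: s1 => //= a s1 IHs /andP[lt_a lt_s1] /andP[dec /(IHs lt_s1) ->].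
rewrite andbT; apply/allP => x s1x; rewrite /geq /= leqNgt; apply/negP => lt_ax.
move: dec; rewrite filter_cat pairwise_cat => /and3P[/allrelP/(_ x K) + _ _].
rewrite !mem_filter lt_ax s1x /= lt_a mem_head => /(_ isT isT).
by rewrite /geq /= leqNgt (allP lt_s1).
Qed.

Lemma desc_le_head s x : pairwise geq s -> x \in s -> x <= head 0 s.
Proof.
by case: s => //= y s /andP[/allP ge_y _]; rewrite inE => /predU1P[->|/ge_y].
Qed.

Section PrefixCount.
Variable M : nat.

Definition prefix_count (k n l : nat) : nat :=
  cnt M n (fun s => [&& letters_lt k s, avoids s & desc_prefix l s]).

Lemma prefix_count_gt k n l : n < l -> prefix_count k n l = 0.
Proof.
move=> lt_nl; rewrite /prefix_count (@eq_cnt _ _ _ pred0) /cnt ?count_pred0 // => s sz_s _.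
by rewrite /desc_prefix sz_s leqNgt lt_nl /= !andbF.
Qed.

(** Words whose longest weakly decreasing prefix has length exactly l. *)
Definition exact_count (k n l : nat) : nat :=
  cnt M n (fun s => [&& letters_lt k s, avoids s, desc_prefix l s
                      & ~~ desc_prefix l.+1 s]).

Lemma prefix_countS k n l : prefix_count k n l = prefix_count k n l.+1 + exact_count k n l.
Proof.
rewrite /prefix_count (cntID _ _ (desc_prefix l.+1)); congr (_ + _); apply: eq_cnt => s _ _.
  case: (boolP (desc_prefix l.+1 s)) => [dec|]; last by rewrite !andbF.
  by rewrite (desc_prefix_le (leqnSn l) dec) !andbT.
by rewrite -!andbA.
Qed.

Lemma exact_count0 k n : 0 < n -> exact_count k n 0 = 0.
Proof.
move=> n_gt0; rewrite /exact_count (@eq_cnt _ _ _ pred0) /cnt ?count_pred0 //.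
by case=> [|x s] sz_s _; [rewrite -sz_s in n_gt0 | rewrite /desc_prefix /= take0 !andbF].
Qed.

Variable K : nat.
Hypothesis lt_KM : K < M.

Lemma letters_ltM s : letters_lt K.+1 s -> letters_lt M s.
Proof. by apply: sub_all => x lt_x; apply: leq_ltn_trans lt_KM. Qed.

Let good l s := [&& letters_lt K.+1 s, avoids s & desc_prefix l s].
Let exact l s := [&& letters_lt K.+1 s, avoids s, desc_prefix l s
                      & ~~ desc_prefix l.+1 s].

Lemma cnt_cons_max n (P Q : pred (seq nat)) :
  (forall s, letters_lt K.+1 s -> P (K :: s) = Q s) ->
  (forall s, P s -> letters_lt K.+1 s) -> (forall s, Q s -> letters_lt K.+1 s) ->
  cnt M n.+1 (fun s => P s && (head 0 s == K)) = cnt M n Q.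
Proof.
move=> PQ leP leQ; apply: (@cnt_bij _ _ _ _ _ behead (cons K)).
  case=> // x s [sz_s] /andP[_ ls] /andP[Ps /= /eqP def_x]; subst x.
  by have /andP[_ le_s] := leP _ Ps; split; rewrite -?PQ.
move=> s sz_s ls Qs; split=> //=; [by rewrite sz_s | by rewrite lt_KM |].
by rewrite PQ ?leQ // Qs eqxx.
Qed.

Lemma avoids_cons_max s : letters_lt K.+1 s -> avoids (K :: s) = avoids s.
Proof. by move=> le_s; apply: (@avoids_insert_max K [::]). Qed.

Lemma desc_prefix_cons_max l s :
  letters_lt K.+1 s -> desc_prefix l.+1 (K :: s) = desc_prefix l s.
Proof.
move=> le_s; rewrite /desc_prefix /= ltnS (_ : all _ _ = true) //.
by apply/allP => x /mem_take /(allP le_s).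
Qed.

Lemma letters_cons_max s : letters_lt K.+1 (K :: s) = letters_lt K.+1 s.
Proof. by rewrite /letters_lt /= ltnSn. Qed.

(** The bijection removes the initial K. *)
Lemma cnt_good_max n l :
  cnt M n.+1 (fun s => good l.+1 s && (head 0 s == K)) = prefix_count K.+1 n l.
Proof.
apply: cnt_cons_max => [s le_s|s /andP[] //|s /andP[] //].
by rewrite /good letters_cons_max avoids_cons_max // desc_prefix_cons_max.
Qed.

Lemma cnt_exact_max n l :
  cnt M n.+1 (fun s => exact l.+1 s && (head 0 s == K)) = exact_count K.+1 n l.
Proof.
apply: cnt_cons_max => [s le_s|s /andP[] //|s /andP[] //].
by rewrite /exact letters_cons_max avoids_cons_max // !desc_prefix_cons_max.
Qed.

(** If a word contains K but does not start with it, the first K follows the maximal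
    weakly decreasing prefix immediately: the letters before that K are weakly
    decreasing and below K.  Deleting this K is a bijection. *)
Lemma cnt_insert_max n l :
  cnt M n.+1 (fun s => exact l.+1 s && (K \in s) && (head 0 s != K)) =
  cnt M n (fun s => good l.+1 s && (head 0 s != K)).
Proof.
have le1 s1 s2 : letters_lt K.+1 (s1 ++ s2) =
    letters_lt K.+1 s1 && letters_lt K.+1 s2 by rewrite /letters_lt all_cat.
apply: (@cnt_bij _ _ _ _ _ (fun s => take l.+1 s ++ drop l.+2 s)
                            (fun s => take l.+1 s ++ K :: drop l.+1 s)).
  move=> s sz_s ls /andP[/andP[/and4P[le_s av /andP[le_l dec] ndec] Ks] hd].
  have [lt_l nthK] : l.+1 < size s /\ nth 0 s l.+1 = K.
    have lt_j : index K s < size s by rewrite index_mem.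
    have hd_max x : x \in s -> x <= K by move/(allP le_s).
    have lt_hd : head 0 s < K.
      by rewrite ltn_neqAle hd hd_max //; case: (s) Ks => // y r; rewrite mem_head.
    have nth_j : nth 0 s (index K s) = K by apply: nth_index.
    have def_s : s = take (index K s) s ++ K :: drop (index K s).+1 s.
      by rewrite -{1}(cat_take_drop (index K s) s) (drop_nth 0) // nth_j.
    have lt_s1 : letters_lt K (take (index K s) s).
      apply/allP => x s1x; rewrite ltn_neqAle hd_max ?(mem_take s1x) // andbT.
      by apply: contraTneq s1x => ->; rewrite in_take // ltnn.
    have dec_j : pairwise geq (take (index K s) s).
      by apply: (@avoids_before_max K _ (drop (index K s).+1 s)); rewrite -?def_s.
    have ge_j : l < index K s.
      rewrite ltnNge; apply/negP => le_j.
      have : K \in take l.+1 s.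
        by rewrite -nth_j -(@nth_take l.+1) ?ltnS // mem_nth // size_takel.
      move/(desc_le_head dec); rewrite leqNgt (_ : head 0 _ = head 0 s) ?lt_hd //.
      by case: (s).
    have le_j : index K s <= l.+1.
      rewrite leqNgt; apply: contra ndec => lt_lj; rewrite /desc_prefix.
      rewrite (leq_trans lt_lj (ltnW lt_j)) -(take_takel _ lt_lj).
      by apply: subseq_pairwise dec_j; apply: take_subseq.
    have eq_j : index K s = l.+1 by apply/eqP; rewrite eqn_leq le_j.
    by rewrite -eq_j.
  have def_s : s = take l.+1 s ++ K :: drop l.+2 s.
    by rewrite -{1}(cat_take_drop l.+1 s) (drop_nth 0) // nthK.
  have [le_s1 le_s2] : letters_lt K.+1 (take l.+1 s) /\ letters_lt K.+1 (drop l.+2 s).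
    by move: le_s; rewrite {1}def_s le1 /= => /andP[-> /andP[]].
  have sz_t : size (take l.+1 s) = l.+1 by rewrite size_take lt_l.
  have tk : take l.+1 (take l.+1 s ++ drop l.+2 s) = take l.+1 s.
    by rewrite take_size_cat.
  have dr : drop l.+1 (take l.+1 s ++ drop l.+2 s) = drop l.+2 s.
    by rewrite drop_size_cat.
  split.
  - by rewrite size_cat sz_t size_drop; lia.
  - by rewrite all_cat; apply/andP; split; apply: letters_ltM.
  - rewrite /good le1 le_s1 le_s2 -(@avoids_insert_max K) // -def_s av.
    rewrite /desc_prefix tk dec size_cat sz_t leq_addr /=.
    by case: (s) hd.
  - by rewrite tk dr -def_s.
move=> s sz_s ls /andP[/and3P[le_s av /andP[le_l dec]] hd].
have sz_t : size (take l.+1 s) = l.+1 by rewrite size_takel.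
have [le_s1 le_s2] : letters_lt K.+1 (take l.+1 s) /\ letters_lt K.+1 (drop l.+1 s).
  by move: le_s; rewrite -{1}(cat_take_drop l.+1 s) le1 => /andP.
have hd_s : head 0 (take l.+1 s) = head 0 s by case: (s).
have ne_t : 0 < size (take l.+1 s) by rewrite sz_t.
split.
- by rewrite size_cat sz_t /= size_drop; lia.
- by rewrite all_cat /= lt_KM /=; apply/andP; split; apply: letters_ltM.
- rewrite /exact le1 le_s1 /= /letters_lt /= ltnSn -/(letters_lt _ _) le_s2.
  rewrite avoids_insert_max // cat_take_drop av mem_cat mem_head orbT andbT.
  rewrite /desc_prefix size_cat sz_t leq_addr take_size_cat // dec /=.
  apply/andP; split; last by case: (s) ne_t hd.
  apply/negP => /andP[_]; rewrite -cat_rcons take_size_cat ?size_rcons ?sz_t //.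
  move/desc_le_head => /(_ K); rewrite mem_rcons mem_head => /(_ isT).
  have -> : head 0 (rcons (take l.+1 s) K) = head 0 s by case: (s) ne_t.
  rewrite leqNgt ltn_neqAle hd (_ : head 0 s <= K) //.
  by case: (s) le_s ne_t => //= y r /andP[].
- rewrite take_size_cat // drop_cat sz_t ltnNge leqnSn /= subSn // subnn /= drop0.
  by rewrite cat_take_drop.
Qed.

Definition prev_count (k n l : nat) : nat := if n is n'.+1 then prefix_count k n' l else 0.

(** Words without K are words on the smaller alphabet.  Among the words with K,
    those starting with K reduce to [exact_count] at (n, l), and the others to
    words of length n with a decreasing prefix of length l + 1 that do not start
    with K; [prev_count] counts those that do. *)
Lemma exact_count_rec n l :
  exact_count K.+1 n.+1 l.+1 + prev_count K.+1 n l =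
  exact_count K n.+1 l.+1 + prefix_count K.+1 n l.
Proof.
have split_exact_count : exact_count K.+1 n.+1 l.+1 =
    cnt M n.+1 (fun s => exact l.+1 s && (K \in s)) + exact_count K n.+1 l.+1.
  rewrite /exact_count (cntID _ _ (fun s => K \in s)); congr (_ + _).
  apply: eq_cnt => s _ _.
  have -> : letters_lt K s = letters_lt K.+1 s && (K \notin s).
    apply/allP/andP => [lt_s|[/allP le_s sK] x sx].
      split; last by apply/negP => /lt_s /=; rewrite ltnn.
      by apply/allP => x /lt_s /= /ltnW.
    have := le_s x sx; rewrite /= ltnS leq_eqVlt => /predU1P[def_x|//].
    by rewrite -def_x sx in sK.
  by case: (letters_lt _ _); case: (K \in s); rewrite ?andbF ?andbT.
have -> : prev_count K.+1 n l = cnt M n (fun s => good l.+1 s && (head 0 s == K)).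
  case: n {split_exact_count} => [|n]; last by rewrite cnt_good_max.
  rewrite /cnt (@eq_in_count _ _ pred0) ?count_pred0 // => s.
  by rewrite mem_word_seqs => /andP[/eqP/size0nil-> _].
rewrite split_exact_count prefix_countS -/good addnAC [in RHS]addnC; congr (_ + _).
rewrite (cntID M _ (fun s => head 0 s == K) (fun s => exact l.+1 s && (K \in s))).
rewrite cnt_insert_max [prefix_count _ _ _](cntID _ _ (fun s => head 0 s == K)).
have -> : cnt M n.+1 (fun s => exact l.+1 s && (K \in s) && (head 0 s == K))
    = exact_count K.+1 n l.
  rewrite -cnt_exact_max; apply: eq_cnt => -[|x s] //= _ _.
  case: (eqVneq x K) => [->|]; rewrite ?andbF //.
  by rewrite mem_head !andbT.
by rewrite [RHS]addnC -addnA; congr (_ + _); rewrite addnC.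
Qed.

End PrefixCount.

Local Open Scope ring_scope.

(** The coefficient of x^n in (x (1 - x))^i, that is (-1)^(n-i) C(i, n-i). *)
Definition xcoef (n i : nat) : int := (('X * (1 - 'X)) ^+ i : {poly int})`_n.

(** Ballot numbers, with generating function x^l c(x)^(l+1) in i, where c is the
    generating function of the Catalan numbers, the case l = 0. *)
Definition ballot (i l : nat) : int :=
  if (l <= i)%N then 'C(i.*2 - l, i)%:Z - 'C(i.*2 - l, i.+1)%:Z else 0.

Lemma xcoef0 n : xcoef n 0 = (n == 0%N)%:R.
Proof. by rewrite /xcoef expr0 coef1. Qed.

Lemma xcoef0S i : xcoef 0 i.+1 = 0.
Proof. by rewrite /xcoef exprS -mulrA coefXM. Qed.

Lemma xcoefSS n i :
  xcoef n.+1 i.+1 = xcoef n i - (if n is n'.+1 then xcoef n' i else 0).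
Proof.
rewrite /xcoef exprS -mulrA coefXM /= mulrBl mul1r coefB coefXM.
by case: n.
Qed.

Lemma xcoef_gt n i : (n < i)%N -> xcoef n i = 0.
Proof.
elim: i n => // i IHi [|n] lt_ni; first by rewrite xcoef0S.
by rewrite xcoefSS IHi //; case: n lt_ni => [|n] lt_ni; rewrite ?IHi ?subr0 //; lia.
Qed.

Lemma ballot_rec i l : ballot i.+1 l.+1 - ballot i.+1 l.+2 = ballot i l.
Proof.
rewrite /ballot !ltnS; case: (ltngtP l i) => [lt_li|lt_il|->].
- have -> : (i.+1.*2 - l.+1 = (i.+1.*2 - l.+2).+1)%N by lia.
  have -> : (i.+1.*2 - l.+2 = i.*2 - l)%N by lia.
  by rewrite !binS !PoszD; lia.
- by rewrite subrr.
- have -> : (i.+1.*2 - i.+1 = i.+1)%N by lia.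
  by rewrite (_ : i.*2 - i = i)%N ?binn ?bin_small //; lia.
Qed.

Lemma ballot_row0 i : ballot i.+1 0 = ballot i.+1 1.
Proof.
rewrite /ballot /= subn0 (_ : i.+1.*2 - 1 = i.*2.+1)%N; last by lia.
rewrite (_ : i.+1.*2 = i.*2.+2)%N; last by lia.
rewrite !(binS i.*2.+1) (_ : 'C(i.*2.+1, i) = 'C(i.*2.+1, i.+1)) ?PoszD; last first.
  by rewrite -bin_sub; [congr 'C(_, _); lia | lia].
lia.
Qed.

(** Closed form of [prefix_count], found by solving the recurrence with the kernel
    method; see [prefix_countE]. *)
Definition ballot_sum (k n l : nat) : int :=
  \sum_(i < n.+1) ballot i l * xcoef n i * 'C((k + i).-1, i)%:Z.

Lemma ballot_sum_widen k n l m : (n < m)%N ->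
  ballot_sum k n l = \sum_(i < m) ballot i l * xcoef n i * 'C((k + i).-1, i)%:Z.
Proof.
move=> lt_nm; rewrite /ballot_sum.
rewrite (big_ord_widen m (fun i => ballot i l * xcoef n i * 'C((k + i).-1, i)%:Z)) //.
rewrite big_mkcond /=.
apply: eq_bigr => i _; case: ifPn => // le_i.
by rewrite xcoef_gt ?mulr0 ?mul0r //; lia.
Qed.

Lemma ballot_sum_gt k n l : (n < l)%N -> ballot_sum k n l = 0.
Proof.
move=> lt_nl; rewrite /ballot_sum big1 // => i _.
by rewrite /ballot leqNgt (leq_trans (ltn_ord i) lt_nl) !mul0r.
Qed.

Lemma ballot_sum_diff k n l : ballot_sum k n.+1 l.+1 - ballot_sum k n.+1 l.+2 =
  \sum_(i < n.+1) ballot i l * xcoef n.+1 i.+1 * 'C(k + i, i.+1)%:Z.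
Proof.
rewrite /ballot_sum -sumrB big_ord_recl /= xcoef0 mulr0 !mul0r subrr add0r.
apply: eq_bigr => i _; rewrite /bump /= add1n.
by rewrite -!mulrBl ballot_rec addnS.
Qed.

(** The same recurrence as [exact_count_rec].  By [ballot_rec] the difference in l
    lowers the index of the ballot numbers, and Pascal's rule turns the difference in
    k into the sum for the pair (n, l). *)
Lemma ballot_sum_rec k n l :
  (ballot_sum k.+1 n.+1 l.+1 - ballot_sum k.+1 n.+1 l.+2)
    + (if n is n'.+1 then ballot_sum k.+1 n' l else 0) =
  (ballot_sum k n.+1 l.+1 - ballot_sum k n.+1 l.+2) + ballot_sum k.+1 n l.
Proof.
suff -> : ballot_sum k.+1 n.+1 l.+1 - ballot_sum k.+1 n.+1 l.+2
    = (ballot_sum k n.+1 l.+1 - ballot_sum k n.+1 l.+2)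
      + (ballot_sum k.+1 n l - (if n is n'.+1 then ballot_sum k.+1 n' l else 0)) by ring.
rewrite !ballot_sum_diff.
have -> : ballot_sum k.+1 n l - (if n is n'.+1 then ballot_sum k.+1 n' l else 0)
    = \sum_(i < n.+1) ballot i l * xcoef n.+1 i.+1 * 'C(k + i, i)%:Z.
  case: n => [|n]; last rewrite (@ballot_sum_widen _ n _ n.+2) // /ballot_sum -sumrB.
    by rewrite subr0 /ballot_sum; apply: eq_bigr => i _; rewrite xcoefSS subr0.
  by apply: eq_bigr => i _; rewrite xcoefSS addSn /=; ring.
rewrite -big_split; apply: eq_bigr => i _ /=.
by rewrite addSn binS PoszD mulrDr.
Qed.

Lemma prefix_count_nil M k l : (prefix_count M k 0 l)%:Z = ballot_sum k 0 l.
Proof.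
have /seq.permP eq_nil : perm_eq (word_seqs M 0) [:: [::]].
  apply: uniq_perm; rewrite ?word_seqs_uniq // => s.
  by rewrite mem_word_seqs inE; case: s.
rewrite /prefix_count /cnt eq_nil /ballot_sum big_ord1 xcoef0 bin0 !mulr1 /ballot.
by case: l => [|l]; rewrite //= /desc_prefix /= !bin0n.
Qed.

Lemma prefix_count0 M n l : (prefix_count M 0 n l)%:Z = ballot_sum 0 n l.
Proof.
case: n => [|n]; last first.
  rewrite /prefix_count (@eq_cnt _ _ _ pred0) /cnt ?count_pred0 => [|[] //].
  rewrite /ballot_sum big1 // => -[[|i] lt_i] _ /=; first by rewrite xcoef0 mulr0 mul0r.
  by rewrite bin_small ?mulr0.
exact: prefix_count_nil.
Qed.

(** Both sides satisfy the same recurrence; it is solved by induction on the alphabet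
    size k, then on the length n, then downwards on l from l > n. *)
Lemma prefix_countE M k n l : (k <= M)%N -> (prefix_count M k n l)%:Z = ballot_sum k n l.
Proof.
elim: k n l => [|K IHK] n l; first by rewrite prefix_count0.
move=> lt_KM; elim/ltn_ind: n l => n IHn l.
have [m le_m] : {m | n.+1 - l <= m}%N by exists (n.+1 - l)%N.
elim: m l le_m => [|m IHm] l le_m.
  by rewrite prefix_count_gt ?ballot_sum_gt //; lia.
case: n IHn IHm le_m => [|n] IHn IHm le_m.
  exact: prefix_count_nil.
rewrite prefix_countS PoszD IHm; last by lia.
case: l le_m => [|l] le_m.
  rewrite exact_count0 // addr0 /ballot_sum; apply: eq_bigr => -[[|i] lt_i] _ /=.
    by rewrite xcoef0 /= !mulr0 !mul0r.
  by rewrite ballot_row0.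
have recW : (prev_count M K.+1 n l)%:Z
    = (if n is n'.+1 then ballot_sum K.+1 n' l else 0).
  by case: (n) IHn => [|n'] IHn //=; apply: IHn; lia.
have := exact_count_rec lt_KM n l; have := ballot_sum_rec K n l; rewrite -recW.
have := prefix_countS M K n.+1 l.+1; have := IHn n (leqnn _) l.
have := IHK n.+1 l.+1 (ltnW lt_KM); have := IHK n.+1 l.+2 (ltnW lt_KM).
lia.
Qed.

Lemma card_words123E n : #|words123 n|%:Z =
  \sum_(i < n.+1) ('C(i.*2, i)%:Z - 'C(i.*2, i.+1)%:Z) * xcoef n i * 'C((n + i).-1, i)%:Z.
Proof.
have := @prefix_countE n n n 0 (leqnn n); rewrite /ballot_sum.
under eq_bigr do rewrite /ballot subn0 /=.
move=> <-; rewrite card_words123 /prefix_count; congr _%:Z; apply: eq_cnt => s sz_s lt_s.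
by rewrite /letters_lt lt_s /desc_prefix take0 /= andbT.
Qed.

(** * Two hypergeometric identities *)

(** The function 1 / (a - b)!, read as 0 when a < b.  With this convention the
    contiguity relations below hold for all a and b, so that hypergeometric
    identities need no boundary cases. *)
Definition invfact (a b : nat) : rat :=
  if (b <= a)%N then ((a - b)`!%:R)^-1 else 0.

Lemma factr_neq0 n : n`!%:R != 0 :> rat.
Proof. by rewrite pnatr_eq0 -lt0n fact_gt0. Qed.

Lemma ratS n : n.+1%:R = n%:R + 1 :> rat.
Proof. by rewrite natr1. Qed.

Lemma invfactSS a b : invfact a.+1 b.+1 = invfact a b.
Proof. by rewrite /invfact ltnS subSS. Qed.

Lemma invfactSr a b : invfact a b.+1 = (a%:R - b%:R) * invfact a b.
Proof.
rewrite /invfact; case: (ltngtP b a) => [lt_ba|lt_ab|->]; last 2 first.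
- by rewrite mulr0.
- by rewrite subrr mul0r.
rewrite -natrB ?(ltnW lt_ba) // (_ : a - b = (a - b.+1).+1)%N; last by lia.
by rewrite factS natrM invfM mulrA mulfV ?mul1r // pnatr_eq0.
Qed.

Lemma invfactSl a b : invfact a b = (a.+1%:R - b%:R) * invfact a.+1 b.
Proof. by rewrite -invfactSS invfactSr. Qed.

Lemma xcoefE n j :
  (xcoef n j)%:~R = (-1) ^+ (n + j) * j`!%:R * invfact n j * invfact j.*2 n :> rat.
Proof.
elim: j n => [|j IHj] n.
  rewrite xcoef0 addn0; case: n => [|n] /=.
    by rewrite /invfact subnn fact0 invr1 !mulr1.
  by rewrite {2}/invfact /= mulr0.
case: n => [|n]; first by rewrite xcoef0S /invfact /= mulr0 mul0r.
have -> : (xcoef n.+1 j.+1)%:~R = (-1) ^+ (n + j) * j`!%:R *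
   (invfact n j * invfact j.*2 n + invfact n j.+1 * invfact j.*2.+1 n) :> rat.
  rewrite xcoefSS intrB IHj mulrDr -!mulrA; congr (_ + _).
  case: n => [|n]; first by rewrite {1}/invfact /= mul0r !mulr0 oppr0.
  by rewrite IHj addSn exprS !invfactSS; ring.
rewrite invfactSr (invfactSl j.*2 n) doubleS !invfactSS factS natrM.
rewrite addSn addnS !exprS -!natr1 -muln2 natrM.
by ring.
Qed.

Definition cbin (j : nat) : rat := (j.*2)`!%:R / (j`!%:R * j`!%:R).

Lemma cbinS j : cbin j.+1 = 2 * (2 * j%:R + 1) / (j%:R + 1) * cbin j.
Proof.
have j1 : j%:R + 1 != 0 :> rat by rewrite natr1 pnatr_eq0.
rewrite /cbin doubleS !factS !natrM -!natr1 -muln2 natrM.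
have := factr_neq0 j; move: (j`!%:R) ((j * 2)`!%:R : rat) => a b a0.
by field; rewrite j1 a0.
Qed.

Lemma cbinE j : ('C(j.*2, j))%:R = cbin j.
Proof.
have : ('C(j.*2, j) * (j`! * j`!) = (j.*2)`!)%N.
  by rewrite -(@bin_fact j.*2 j) -addnn ?addnK ?leq_addr.
move/(congr1 (fun k => k%:R : rat)); rewrite !natrM /cbin => <-.
by rewrite mulfK // mulf_neq0 ?factr_neq0.
Qed.

Lemma binDE n j : ('C(n + j, j))%:R = (n + j)`!%:R / (j`!%:R * n`!%:R) :> rat.
Proof.
have /(congr1 (fun k => k%:R : rat)) := bin_fact (leq_addl n j).
by rewrite addnK !natrM => <-; rewrite mulfK // mulf_neq0 ?factr_neq0.
Qed.

(** The hypergeometric term t(n, j); its sums are the coefficients of B. *)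
Definition bterm (n j : nat) : int := xcoef n j * 'C(j.*2, j)%:Z * 'C(n + j, j)%:Z.

Definition bseq (n : nat) : int := \sum_(j < n.+1) bterm n j.

Lemma btermE n j : (bterm n j)%:~R =
  (-1) ^+ (n + j) * cbin j * invfact n j * invfact j.*2 n * ((n + j)`!%:R / n`!%:R).
Proof.
rewrite /bterm !intrM xcoefE -!pmulrn cbinE binDE.
have := factr_neq0 j; have := factr_neq0 n.
move: (n`!%:R) (j`!%:R) ((n + j)`!%:R : rat) => a b c a0 b0.
by field; rewrite a0 b0.
Qed.

Lemma bterm_gt n j : (n < j)%N -> bterm n j = 0.
Proof. by move=> lt_nj; rewrite /bterm xcoef_gt // !mul0r. Qed.

Lemma bseq_widen n m : (n < m)%N -> bseq n = \sum_(j < m) bterm n j.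
Proof.
move=> lt_nm; rewrite /bseq (big_ord_widen m (bterm n)) // big_mkcond /=.
by apply: eq_bigr => i _; case: ifPn => // lt_i; rewrite bterm_gt //; lia.
Qed.

Lemma sum_telescope (V : zmodType) (u : nat -> V) n :
  \sum_(j < n) (u j.+1 - u j) = u n - u 0%N.
Proof. by rewrite -(big_mkord xpredT (fun j => u j.+1 - u j)) telescope_sumr. Qed.

(** Zeilberger's algorithm: the combination of summands is the difference U (j+1) - U j
    of a rational multiple of the summand, and U vanishes at both ends. *)
Lemma bseq_rec m :
  2 * (m.+2%:Z) ^+ 2 * bseq m.+2 =
  (29 * m.+1%:Z ^+ 2 + 29 * m.+1%:Z + 8) * bseq m.+1
   - 3 * (9 * m.+1%:Z ^+ 2 - 1) * bseq m.
Proof.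
apply: (@intr_inj rat); apply/eqP; rewrite -subr_eq0 -intrB.
rewrite (@bseq_widen m.+2 m.+3) ?(@bseq_widen m.+1 m.+3) ?(@bseq_widen m m.+3) //;
  last by lia.
rewrite !mulr_sumr -!sumrB rmorph_sum /=.
(* beta j is the factor common to the three summands and to U. *)
pose beta j : rat := (-1) ^+ (m + j) * cbin j * ((m + j)`!%:R / m.+2`!%:R)
   * invfact m.+2 j * invfact j.*2 m.
pose x : rat := m%:R.
pose U (j : nat) : rat := let y : rat := j%:R in 2 * beta j * y * (2 * y - x)
   * (2 * y - x - 1) * (x + 2) * ((x + 2) - (5 * x + 9) * y + y ^+ 2).
rewrite (eq_bigr (fun j : 'I__ => U j.+1 - U j)) => [|j _].
  by rewrite sum_telescope /U /beta {1}/invfact ltnn /= !(mulr0, mul0r) subrr.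
move: (nat_of_ord j) => {}j.
move: (btermE m j) (btermE m.+1 j) (btermE m.+2 j).
move: (bterm m j) (bterm m.+1 j) (bterm m.+2 j) => t0 t1 t2 E0 E1 E2.
rewrite !(rmorph_nat, rmorph1, rmorphXn, intrB, intrM, intrD) /= E0 E1 E2.
rewrite {t0 t1 t2 E0 E1 E2}.
have m2 : x + 1 + 1 != 0 by rewrite /x !natr1 pnatr_eq0.
have m1 : x + 1 != 0 by rewrite /x natr1 pnatr_eq0.
have j1 : j%:R + 1 != 0 :> rat by rewrite natr1 pnatr_eq0.
rewrite /U /beta.
rewrite doubleS invfactSS (invfactSl m j) (invfactSl m.+1 j).
rewrite (invfactSr j.*2 m.+1) (invfactSr j.*2 m) (invfactSl j.*2 m).
rewrite (invfactSl j.*2.+1 m).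
rewrite !(addSn, addnS) !exprS cbinS !factS !natrM -!natr1 -/x -!muln2 !natrM -/x.
have := factr_neq0 m; move: (m`!%:R) ((m + j)`!%:R : rat) => a b a0.
move: ((-1) ^+ _) (cbin j) (invfact _ _) (invfact _ _) => s c f g.
rewrite -!pmulrn -!natr1 !natrD -/x.
by field; rewrite ?a0 ?j1 ?m1 ?m2.
Qed.

Definition count123 (n : nat) : int := #|words123 n|%:Z.

(** The multiplier n (n - 1) (3 n + 1) is what makes f(n) a combination of b(n) and
    sum_j j t(n, j) with polynomial coefficients.  The difference of the summands of
    both sides is telescoping, as in [bseq_rec]. *)
Lemma count123_bterm n : 6 * n%:Z * (n%:Z - 1) * (3 * n%:Z + 1) * count123 n =
  \sum_(j < n.+1) bterm n j * (n%:Z * (45 * n%:Z ^+ 2 - 3 * n%:Z - 10)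
                                - 4 * (9 * n%:Z ^+ 2 + n%:Z - 2) * j%:Z).
Proof.
case: n => [|m].
  by rewrite big_ord1 /=; ring.
set n := m.+1; apply: (@intr_inj rat); apply/eqP; rewrite -subr_eq0 -intrB.
rewrite /count123 card_words123E mulr_sumr -!sumrB rmorph_sum /=.
pose g j : rat := (-1) ^+ (n + j) * cbin j * ((m + j)`!%:R / m`!%:R)
   * invfact n j * invfact j.*2 n.
pose x : rat := m%:R + 1.
pose U (j : nat) : rat := let y : rat := j%:R in g j * (2 * y - x)
   * (2 * y - x - 1) / (x * (x + 1))
     * (3 * x ^+ 2 + 9 * x ^+ 3 + y * (9 * x ^+ 2 + x - 2)).
rewrite (eq_bigr (fun j : 'I__ => U j.+1 - U j)) => [|j _].
  rewrite sum_telescope /U /g {1}/invfact ltnn {2}/invfact /=.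
  by rewrite !(mulr0, mul0r) subrr.
move: (nat_of_ord j) => {}j.
have x1 : x + 1 != 0 by rewrite /x !natr1 pnatr_eq0.
have x0 : x != 0 by rewrite /x natr1 pnatr_eq0.
have j1 : j%:R + 1 != 0 :> rat by rewrite natr1 pnatr_eq0.
have catE : ('C(j.*2, j)%:Z - 'C(j.*2, j.+1)%:Z)%:~R = cbin j / (j%:R + 1).
  have : (j.+1 * 'C(j.*2, j.+1) = j * 'C(j.*2, j))%N.
    by rewrite mul_bin_left -addnn addnK.
  move/(congr1 (fun k => k%:R : rat)); rewrite !natrM -natr1 cbinE => E.
  rewrite intrB -!pmulrn cbinE; apply: (mulIf j1); rewrite mulfVK //.
  by rewrite mulrBl [X in _ - X]mulrC E; ring.
have binE : 'C((n + j).-1, j)%:Z%:~R = (m + j)`!%:R / (j`!%:R * m`!%:R) :> rat.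
  by rewrite /n addSn /= -pmulrn binDE.
have := btermE n j; move: (bterm n j) => t0 E0.
have := xcoefE n j; move: (xcoef n j) => t1 E1.
move: (_ - _ : int) catE => t2 E2; move: (Posz 'C(_, _)) binE => t3 E3.
rewrite !(rmorph_nat, rmorph1, rmorphXn, intrB, intrM, intrD) /= E0 E1 E2 E3.
rewrite {t0 t1 t2 t3 E0 E1 E2 E3} -!pmulrn.
rewrite /U /g /n doubleS invfactSS (invfactSl m j) (invfactSS j.*2.+1 m).
rewrite (invfactSr j.*2 m) (invfactSl j.*2 m).
rewrite !(addSn, addnS) !exprS cbinS !factS !natrM mulrN1z.
rewrite !(ratS (m + j)) natrD !(ratS m) !(ratS j) !(ratS j.*2) -muln2 natrM /x.
have a0 := factr_neq0 m; have b0 := factr_neq0 j.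
move: (m`!%:R) (j`!%:R) ((m + j)`!%:R : rat) a0 b0 => a b c a0 b0.
move: ((-1) ^+ _) (cbin j) (invfact _ _) (invfact _ _) => s d f h.
rewrite /x {U x} in x1 x0 *.
by field; rewrite a0 b0 x0 x1 j1.
Qed.

(** * Lucas congruences *)

(** Since u has degree below p, digits in base p do not interact: there is no carry. *)
Lemma coef_mul_comp_Xn (R : comNzRingType) (p : nat) (u v : {poly R}) n0 n1 :
  (size u <= p)%N -> (n0 < p)%N ->
  (u * (v \Po 'X^p))`_(n0 + p * n1) = u`_n0 * v`_n1.
Proof.
move=> size_u lt_n0; have p_gt0 : (0 < p)%N by apply: leq_ltn_trans lt_n0.
have lt_n : (n0 < (n0 + p * n1).+1)%N by rewrite ltnS leq_addr.
rewrite coefM (bigD1 (Ordinal lt_n)) //= addKn coef_comp_poly_Xn //.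
rewrite dvdn_mulr // mulKn // big1 ?addr0 // => i; rewrite -val_eqE /= => ne_i.
have [le_pi|lt_ip] := leqP p i; first by rewrite nth_default ?mul0r // (leq_trans size_u).
rewrite coef_comp_poly_Xn //; case: ifP => [p_dvd|]; last by rewrite mulr0.
case/negP: ne_i; move: lt_ip (ltn_ord i) p_dvd; move: (nat_of_ord i) => k.
rewrite ltnS => lt_kp le_k; rewrite -eqn_mod_dvd //.
by rewrite addnC mulnC modnMDl !modn_small // eq_sym.
Qed.

Section ModP.
Variables (p : nat) (p_pr : prime p).
Local Notation F := 'F_p.

Let p_gt0 : (0 < p)%N := prime_gt0 p_pr.

Lemma poly_expp (q : {poly F}) : q ^+ p = q \Po 'X^p.
Proof.
have chF : p \in [pchar {poly F}] by rewrite pchar_poly pchar_Fp.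
elim/poly_ind: q => [|q c IHq]; first by rewrite comp_poly0 expr0n gtn_eqF.
rewrite comp_polyD comp_polyM comp_polyX comp_polyC -IHq.
rewrite -!(pFrobenius_autE chF) pFrobenius_autD_comm; last exact: mulrC.
have := expf_card c; rewrite (card_Fp p_pr) => cp.
by rewrite !pFrobenius_autE exprMn -rmorphXn /= cp.
Qed.

Lemma coef_add1Xn n k : ((1 + 'X) ^+ n : {poly F})`_k = 'C(n, k)%:R.
Proof.
elim: n k => [|n IHn] [|k]; rewrite ?bin0 ?bin0n ?expr0 ?coef1 //.
  by rewrite exprS mulrDl mul1r coefD coefXM addr0 IHn bin0.
by rewrite exprS mulrDl mul1r coefD coefXM /= !IHn binS natrD.
Qed.

Lemma bin_lucas n0 n1 k0 k1 : (n0 < p)%N -> (k0 < p)%N ->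
  'C(n0 + p * n1, k0 + p * k1)%:R = 'C(n0, k0)%:R * 'C(n1, k1)%:R :> F.
Proof.
move=> lt_n lt_k; rewrite -!coef_add1Xn exprD [(p * n1)%N]mulnC exprM poly_expp.
rewrite coef_mul_comp_Xn // (leq_trans (size_poly_exp_leq _ _)) //.
by rewrite -[1]/(1%:P) addrC size_XaddC mul1n.
Qed.

(** A carry in a0 + b0 makes both sides vanish. *)
Lemma bin_add_lucas a0 a1 b0 b1 : (a0 < p)%N -> (b0 < p)%N ->
  'C(a0 + p * a1 + (b0 + p * b1), b0 + p * b1)%:R =
  'C(a0 + b0, b0)%:R * 'C(a1 + b1, b1)%:R :> F.
Proof.
move=> lt_a lt_b; rewrite addnACA -mulnDr.
have [lt_ab|le_p] := ltnP (a0 + b0) p; first exact: bin_lucas.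
have lt_r : (a0 + b0 - p < p)%N by lia.
have C0 : 'C(a0 + b0 - p, b0) = 0%N by rewrite bin_small //; lia.
have -> : (a0 + b0 + p * (a1 + b1) = (a0 + b0 - p) + p * (a1 + b1).+1)%N.
  by rewrite mulnS; lia.
have -> : 'C(a0 + b0, b0)%:R = 0 :> F.
  have -> : (a0 + b0 = (a0 + b0 - p) + p * 1)%N by lia.
  by rewrite -{2}[b0]addn0 -(muln0 p) bin_lucas // C0 mul0r.
by rewrite bin_lucas // C0 !mul0r.
Qed.

(** The hypothesis on j0 keeps the degree 2 j0 of (x (1 - x))^j0 below p. *)
Lemma xcoef_lucas n0 n1 j0 j1 : (n0 < p)%N -> (j0.*2 < p)%N ->
  (xcoef (n0 + p * n1) (j0 + p * j1))%:~R = (xcoef n0 j0)%:~R * (xcoef n1 j1)%:~R :> F.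
Proof.
move=> lt_n lt_j.
have xE n j : (xcoef n j)%:~R = (('X * (1 - 'X)) ^+ j)`_n :> F.
  rewrite /xcoef -(coef_map intr) /= rmorphXn rmorphM rmorphB /= map_polyX.
  by rewrite rmorph1.
rewrite !xE exprD [(p * j1)%N]mulnC exprM poly_expp coef_mul_comp_Xn //.
rewrite (leq_trans (size_poly_exp_leq _ _)) //.
have : (size ('X * (1 - 'X) : {poly F})%R <= 3)%N.
  rewrite (leq_trans (size_polyMleq _ _)) // size_polyX /=.
  by rewrite -opprB size_polyN -polyC1 size_XsubC.
move: (size _) => s le_s; suff : (s.-1 * j0 <= 2 * j0)%N by lia.
by rewrite leq_mul2r; lia.
Qed.

(** If 2 j0 >= p, where [xcoef_lucas] does not apply, the central binomial coefficient
    vanishes modulo p on both sides. *)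
Lemma bterm_lucas n0 n1 j0 j1 : (n0 < p)%N -> (j0 < p)%N ->
  (bterm (n0 + p * n1) (j0 + p * j1))%:~R =
  (bterm n0 j0)%:~R * (bterm n1 j1)%:~R :> F.
Proof.
move=> lt_n lt_j; rewrite /bterm !intrM -!pmulrn -!addnn !bin_add_lucas //.
have [lt_2j|le_p] := ltnP j0.*2 p; first by rewrite xcoef_lucas //; ring.
suff -> : 'C(j0 + j0, j0)%:R = 0 :> F by rewrite !(mul0r, mulr0).
have -> : (j0 + j0 = (j0.*2 - p) + p * 1)%N by lia.
rewrite -{2}[j0]addn0 -(muln0 p) bin_lucas //; last by lia.
by rewrite bin_small ?mul0r //; lia.
Qed.

(** The weight takes n and j modulo p as arguments, hence depends only on the lowest
    digit in base p. *)
Definition weighted_sum (w : F -> F -> F) (n : nat) : F :=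
  \sum_(j < n.+1) (bterm n j)%:~R * w n%:R j%:R.

Lemma weighted_sum_widen w n m : (n < m)%N ->
  weighted_sum w n = \sum_(j < m) (bterm n j)%:~R * w n%:R j%:R.
Proof.
move=> lt_nm; rewrite /weighted_sum.
rewrite (big_ord_widen m (fun j => (bterm n j)%:~R * w n%:R j%:R)) //.
rewrite big_mkcond /=.
by apply: eq_bigr => i _; case: ifPn => // lt_i; rewrite bterm_gt ?mul0r //; lia.
Qed.

Lemma sum_ord_mul (V : nmodType) (u : nat -> V) q m :
  \sum_(j < q * m) u j = \sum_(j1 < m) \sum_(j0 < q) u (j0 + q * j1)%N.
Proof.
elim: m => [|m IHm]; first by rewrite muln0 !big_ord0.
rewrite big_ord_recr /= -IHm mulnS addnC big_split_ord /=; congr (_ + _).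
by apply: eq_bigr => i _; rewrite addnC.
Qed.

Lemma weighted_sum_lucas w n0 n1 : (n0 < p)%N ->
  weighted_sum w (n0 + p * n1) = weighted_sum w n0 * (bseq n1)%:~R.
Proof.
move=> lt_n; rewrite (@weighted_sum_widen w _ (p * n1.+1)); last by rewrite mulnS; lia.
rewrite (sum_ord_mul (fun j => (bterm (n0 + p * n1) j)%:~R * w (n0 + p * n1)%:R j%:R)).
rewrite (@weighted_sum_widen w n0 p) // /bseq rmorph_sum /= mulr_sumr.
apply: eq_bigr => j1 _; rewrite mulr_suml; apply: eq_bigr => j0 _.
rewrite bterm_lucas // !natrD !natrM pchar_Fp_0 // !mul0r !addr0.
by rewrite mulrAC.
Qed.

Lemma bseq_wsum n : (bseq n)%:~R = weighted_sum (fun _ _ => 1) n.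
Proof.
by rewrite /bseq /weighted_sum rmorph_sum /=; apply: eq_bigr => j _; rewrite mulr1.
Qed.

Lemma bseq_lucas n0 n1 : (n0 < p)%N ->
  (bseq (n0 + p * n1))%:~R = (bseq n0)%:~R * (bseq n1)%:~R :> F.
Proof. by move=> lt_n; rewrite !bseq_wsum weighted_sum_lucas // bseq_wsum. Qed.

Definition gseq (n : nat) : int :=
  6 * n%:Z * (n%:Z - 1) * (3 * n%:Z + 1) * count123 n.

Lemma gseq_wsum n : (gseq n)%:~R =
  weighted_sum (fun x y => x * (45 * x ^+ 2 - 3 * x - 10) - 4 * (9 * x ^+ 2 + x - 2) * y) n.
Proof.
rewrite /gseq count123_bterm /weighted_sum rmorph_sum /=; apply: eq_bigr => j _.
move: (bterm n j) => t.
by rewrite !(rmorph_nat, rmorph1, rmorphXn, intrB, intrM, intrD) -!pmulrn.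
Qed.

Lemma gseq_lucas n0 n1 : (n0 < p)%N ->
  (gseq (n0 + p * n1))%:~R = (gseq n0)%:~R * (bseq n1)%:~R :> F.
Proof. by move=> lt_n; rewrite !gseq_wsum weighted_sum_lucas. Qed.

End ModP.

(** * Generating functions modulo a prime *)

Section FpsCoef.
Variable K : fieldType.
Implicit Types (f g : fps K) (a b : {poly K}).

Lemma fps_mul_coef f g a b n :
    (forall i, (i <= n)%N -> f i = a`_i) -> (forall i, (i <= n)%N -> g i = b`_i) ->
  (f * g) n = (a * b)`_n.
Proof.
move=> fa gb; rewrite coefM /=; apply: eq_bigr => i _.
by rewrite fa ?gb ?leq_subr // -ltnS.
Qed.

Lemma fps_exp_trunc f m k n :
  (n < m)%N -> (f ^+ k) n = ((fps_trunc m f) ^+ k)`_n.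
Proof.
elim: k n => [|k IHk] n lt_nm; first by rewrite !expr0 coef1.
rewrite !exprS; apply: fps_mul_coef => i le_in.
  by rewrite coef_fps_trunc // (leq_ltn_trans le_in).
by rewrite IHk // (leq_ltn_trans le_in).
Qed.

End FpsCoef.

(** Multiplicativity in base p digits says that the series is its truncation below
    degree p times b(z^p), and b(z^p) = b(z)^p over F_p. *)
Lemma fps_lucas (p : nat) (p_pr : prime p) (s a b : nat -> 'F_p) :
    (forall n0 n1, (n0 < p)%N -> s (n0 + p * n1)%N = a n0 * b n1) ->
  Fps s = poly_fps (\poly_(i < p) a i) * Fps b ^+ p.
Proof.
move=> sab; apply: fpsP => n; set f := Fps b.
rewrite (@fps_mul_coef _ _ _ (\poly_(i < p) a i) ((fps_trunc n.+1 f) ^+ p)) //; last first.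
  by move=> i le_in; rewrite (@fps_exp_trunc _ f n.+1).
have bq : (fps_trunc n.+1 f)`_(n %/ p) = b (n %/ p)%N.
  by rewrite coef_fps_trunc // ltnS leq_div.
have lt_r : (n %% p < p)%N by rewrite ltn_mod prime_gt0.
have def_n : n = (n %% p + p * (n %/ p))%N by rewrite addnC mulnC -divn_eq.
move: (fps_trunc _ _) bq => t bq; rewrite [in RHS]def_n poly_expp //.
rewrite coef_mul_comp_Xn ?size_poly // bq coef_poly lt_r -sab //.
by rewrite -def_n.
Qed.

Section GenfunModP.
Variables (p : nat) (p_pr : prime p).
Local Notation F := 'F_p.

Definition int_fps (K : fieldType) (s : nat -> int) : fps K := Fps (fun n => (s n)%:~R).

Definition int_poly (s : nat -> int) : {poly F} := \poly_(i < p) (s i)%:~R.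

Lemma bseq_fps : int_fps F bseq = poly_fps (int_poly bseq) * int_fps F bseq ^+ p.
Proof. by apply: fps_lucas => // n0 n1; apply: bseq_lucas. Qed.

Lemma gseq_fps : int_fps F gseq = poly_fps (int_poly gseq) * int_fps F bseq ^+ p.
Proof. by apply: fps_lucas => // n0 n1; apply: gseq_lucas. Qed.

Lemma bseq0 : bseq 0 = 1.
Proof. by rewrite /bseq big_ord1 /bterm xcoef0. Qed.

Lemma bseq1 : bseq 1 = 4.
Proof.
rewrite /bseq !big_ord_recl big_ord0 /bterm /= /bump /= xcoef0 xcoefSS xcoef0 /=.
by rewrite !mul0r add0r addr0 subr0 mul1r.
Qed.

Lemma gseq2 : gseq 2 = 336.
Proof.
rewrite /gseq /count123 card_words123E !big_ord_recl big_ord0 /= /bump /=.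
by rewrite !xcoefSS xcoef0S !xcoef0.
Qed.

Lemma bseq_poly_exp : int_fps F bseq ^+ p.-1 * poly_fps (int_poly bseq) = 1.
Proof.
have B0 : int_fps F bseq != 0.
  apply/eqP => /(congr1 (fun f : fps F => f 0%N)) /= /eqP.
  by rewrite bseq0 oner_eq0.
apply: (mulfI B0); rewrite mulr1 mulrA -exprS prednK ?prime_gt0 // mulrC.
by rewrite -bseq_fps.
Qed.

(** Eliminating B from B = A B^p and G = A1 B^p. *)
Lemma gseq_poly_exp :
  poly_fps (int_poly bseq ^+ p) * int_fps F gseq ^+ p.-1 = poly_fps (int_poly gseq ^+ p.-1).
Proof.
rewrite gseq_fps !rmorphXn exprMn -exprM mulnC exprM mulrCA [X in _ * X]mulrC -exprMn.
by rewrite bseq_poly_exp expr1n mulr1.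
Qed.

End GenfunModP.

(** * Kummer theory over F_p(z) *)

Definition poly_laurent (K : fieldType) (q : {poly K}) : laurent K :=
  fps_laurent (poly_fps q).

HB.instance Definition _ (K : fieldType) :=
  GRing.RMorphism.copy (@poly_laurent K) (@fps_laurent K \o @poly_fps K).

Lemma fps_laurent_inj (K : fieldType) : injective (@fps_laurent K).
Proof.
move=> f g /eqP; rewrite -subr_eq0 -rmorphB fps_laurent_eq0 subr_eq0.
by move/eqP.
Qed.

Lemma poly_laurent_inj (K : fieldType) : injective (@poly_laurent K).
Proof. by move=> q r /fps_laurent_inj/poly_fps_inj. Qed.

Lemma poly_laurent_eq0 (K : fieldType) (q : {poly K}) :
  (poly_laurent q == 0) = (q == 0).
Proof. by rewrite -(inj_eq (@poly_laurent_inj K)) rmorph0. Qed.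

Lemma expr_predr (R : pzRingType) (y : R) n : (0 < n)%N -> y ^+ n = y * y ^+ n.-1.
Proof. by move=> n_gt0; rewrite -exprS prednK. Qed.

Section Kummer.
Variables (p : nat) (p_pr : prime p).
Local Notation F := 'F_p.
Local Notation E := (laurent F).
Local Notation "P ^^" := (map_poly (@poly_laurent F) P) (at level 2).

(** As V = U g^(p-1), the roots of U X^p - V X are the multiples of g by the elements
    of F_p. *)
Lemma kummer_factor (U V : {poly F}) (g : E) :
    U != 0 -> g != 0 -> poly_laurent U * g ^+ p.-1 = poly_laurent V ->
  (U *: 'X^p - V *: 'X)^^ =
    poly_laurent U *: \prod_(x <- enum F) ('X - (poly_laurent x%:P * g)%:P).
Proof.
move=> U0 g0 UgV; have u0 : poly_laurent U != 0 by rewrite poly_laurent_eq0.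
have p_gt1 := prime_gt1 p_pr.
rewrite -(big_map (fun x : F => poly_laurent x%:P * g) xpredT (fun c => 'X - c%:P)).
set rs := map _ _; set N := _^^.
have NE : N = poly_laurent U *: 'X^p - poly_laurent V *: 'X.
  by rewrite /N rmorphB /= !map_polyZ /= map_polyXn map_polyX.
have size_N : size N = p.+1.
  rewrite NE size_polyDl size_scale ?size_polyXn //.
  rewrite size_polyN (leq_ltn_trans (size_scale_leq _ _)) // size_polyX.
  by rewrite ltnS.
have lead_N : lead_coef N = poly_laurent U.
  rewrite lead_coefE size_N NE /= coefB !coefZ coefXn coefX eqxx.
  by rewrite gtn_eqF // mulr1 mulr0 subr0.
rewrite -lead_N; apply: all_roots_prod_XsubC.
- by rewrite size_N size_map -cardE card_Fp.
- apply/allP => c /mapP[x _ ->]; rewrite /root NE hornerD hornerN !hornerZ.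
  rewrite hornerXn hornerX -UgV exprMn.
  have := expf_card x; rewrite card_Fp // => xp.
  rewrite -rmorphXn /= -polyC_exp xp (expr_predr g (prime_gt0 p_pr)).
  by rewrite subr_eq0; apply/eqP; ring.
- rewrite uniq_rootsE map_inj_uniq ?enum_uniq // => x y /(mulIf g0).
  by move/poly_laurent_inj/polyC_inj.
Qed.

(** Either a smaller relation for g is found, or P divides U X^p - V X up to a
    scalar.  In the latter case all roots of P are multiples of g by constants, and
    the product of the roots, which is rational, is a constant times a power of g. *)
Lemma kummer (U V : {poly F}) (g : E) (P : {poly {poly F}}) :
    U != 0 -> V != 0 -> poly_laurent U * g ^+ p.-1 = poly_laurent V ->
    P != 0 -> (P^^).[g] = 0 ->
  exists e (l m : {poly F}), [/\ (0 < e < size P)%N, l != 0, m != 0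
                               & poly_laurent l * g ^+ e = poly_laurent m].
Proof.
move=> U0 V0 UgV; have p_gt1 := prime_gt1 p_pr.
have g0 : g != 0.
  apply: contraNneq V0 => g0; rewrite -poly_laurent_eq0 -UgV g0 expr0n.
  by rewrite -subn1 subn_eq0 leqNgt p_gt1 mulr0.
move: {2}(size P) (leqnn (size P)) => n.
elim: n P => [|n IHn] P le_n P0 Pg; first by rewrite leqn0 size_poly_eq0 (negPf P0) in le_n.
pose N := U *: 'X^p - V *: 'X; have N_g : (N^^).[g] = 0.
  rewrite rmorphB /= !map_polyZ /= map_polyXn map_polyX !hornerE -UgV.
  by rewrite (expr_predr g (prime_gt0 p_pr)); ring.
have divN := Pdiv.Idomain.divp_eq N P.
have lt_n (Q : {poly {poly F}}) : (size Q < size P)%N -> Q != 0 -> (Q^^).[g] = 0 ->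
    exists e (l m : {poly F}), [/\ (0 < e < size P)%N, l != 0, m != 0
                               & poly_laurent l * g ^+ e = poly_laurent m].
  move=> lt_QP Q0 Qg; have [|e [l [m [/andP[e0 e_lt] l0 m0 lgm]]]] := IHn Q _ Q0 Qg.
    by rewrite -ltnS (leq_trans lt_QP).
  by exists e, l, m; rewrite e0 (ltn_trans e_lt).
have [P_dvd|ndvd] := eqVneq (N %% P) 0; last first.
  apply: (lt_n (N %% P)) => //; first by rewrite ltn_modp.
  move/(congr1 (fun Q => (Q^^).[g])): divN.
  by rewrite rmorphD rmorphM /= map_polyZ /= hornerD hornerM hornerZ N_g Pg !mulr0 add0r.
have [P_0|P_0] := eqVneq P`_0 0.
  have /factor_theorem[Q def_P] : root P 0 by rewrite /root horner_coef0 P_0.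
  rewrite subr0 in def_P.
  have Q0 : Q != 0 by apply: contraNneq P0 => Q0; rewrite def_P Q0 mul0r.
  apply: (lt_n Q) => //; first by rewrite def_P size_mulX.
  apply: (mulIf g0); rewrite mul0r -Pg def_P rmorphM /= map_polyX hornerM hornerX //.
have [m] : {m | P^^ %= \prod_(x <- mask m (enum F)) ('X - (poly_laurent x%:P * g)%:P)}.
  apply: dvdp_prod_XsubC.
  rewrite -(@dvdpZr _ (poly_laurent U)) ?poly_laurent_eq0 // -(kummer_factor U0 g0 UgV) -/N.
  have c0 : poly_laurent (lead_coef P ^+ scalp N P) != 0.
    by rewrite poly_laurent_eq0 expf_neq0 // lead_coef_eq0.
  rewrite -(@dvdpZr _ _ _ _ c0) -map_polyZ divN P_dvd addr0 rmorphM /=.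
  exact: dvdp_mull.
move: (mask m _) => t; set Pi := \prod_(x <- t) _ => PPi.
have sz_t : size P = (size t).+1.
  rewrite -(size_map_poly_id0 (f := @poly_laurent F)) ?poly_laurent_eq0 ?lead_coef_eq0 //.
  by rewrite (eqp_size PPi) size_prod_XsubC.
have PE : P^^ = poly_laurent (lead_coef P) *: Pi.
  have := eqp_eq PPi; rewrite (monicP (monic_prod_XsubC _ _ _)) scale1r => {1}->.
  by rewrite lead_coef_map_id0 ?rmorph0 // poly_laurent_eq0 lead_coef_eq0.
have P0E : poly_laurent P`_0 =
    poly_laurent (lead_coef P * \prod_(x <- t) - x%:P) * g ^+ size t.
  rewrite -coef_map PE coefZ -horner_coef0 horner_prod rmorphM /= -mulrA.
  rewrite rmorph_prod /=; congr (_ * _).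
  elim: (t) => [|x r IHr]; first by rewrite !big_nil expr0 mulr1.
  rewrite !big_cons IHr /= exprS !hornerE rmorphN /=; ring.
exists (size t), (lead_coef P * \prod_(x <- t) - x%:P), P`_0; split=> //.
- rewrite sz_t ltnSn andbT lt0n; apply/eqP => t0.
  have P1 : (size P <= 1)%N by rewrite sz_t t0.
  move: Pg; rewrite (size1_polyC P1) map_polyC hornerC /= => /eqP.
  by rewrite poly_laurent_eq0 (negPf P_0).
- by apply: contraNneq P_0 => l0; rewrite -poly_laurent_eq0 P0E l0 rmorph0 mul0r.
Qed.
End Kummer.

(** * Multiple factors of polynomial solutions of differential equations *)

Section OdePoly.
Variables (p : nat) (p_pr : prime p).
Local Notation F := 'F_p.
Implicit Types (A P Q g u v : {poly F}).

Lemma natFp_neq0 n : (0 < n < p)%N -> n%:R != 0 :> F.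
Proof.
case/andP=> n_gt0 lt_np; rewrite -(dvdn_pcharf (pchar_Fp p_pr)).
by rewrite gtnNdvd.
Qed.

Lemma exists_irreducible A : (1 < size A)%N ->
  exists2 g, irreducible_poly g & g %| A.
Proof.
move: {2}(size A) (leqnn (size A)) => n.
elim: n A => [|n IHn] A le_n A1; first by rewrite leqNgt (ltnW A1) in le_n.
have A0 : A != 0 by rewrite -size_poly_gt0 ltnW.
have [irrA|nirr] := boolp.EM (irreducible_poly A); first by exists A.
have [d [d1 dA ndA]] : exists d : {poly F}, [/\ size d != 1, d %| A & ~~ (d %= A)].
  apply: boolp.contrapT => nex; apply: nirr; split=> // d d1 dA.
  by apply: boolp.contrapT => /negP ndA; apply: nex; exists d.
have d0 : d != 0 by apply: contraNneq A0 => d0; rewrite d0 dvd0p in dA.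
have lt_dA : (size d < size A)%N.
  rewrite ltn_neqAle dvdp_leq // andbT; apply: contra ndA => /eqP.
  by rewrite -dvdp_size_eqp // => ->.
have [||g irr_g g_d] := IHn d; first by rewrite -ltnS (leq_trans lt_dA).
  by rewrite ltn_neqAle eq_sym d1 size_poly_gt0.
by exists g => //; apply: dvdp_trans g_d dA.
Qed.

Lemma irreducible_dvdp_mul g u v :
  irreducible_poly g -> g %| u * v -> (g %| u) || (g %| v).
Proof.
case=> g1 irr g_uv; case: (boolP (coprimep g u)) => [cop|].
  by move: g_uv; rewrite Gauss_dvdpr // orbC => ->.
rewrite /coprimep => /irr /(_ (dvdp_gcdl _ _)) eq_g.
by rewrite -(eqp_dvdl _ eq_g) dvdp_gcdr.
Qed.

Lemma irreducible_dvdp_exp g u k : irreducible_poly g -> g %| u ^+ k -> g %| u.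
Proof.
move=> irr; elim: k => [|k IHk]; last by rewrite exprS => /(irreducible_dvdp_mul irr)/orP[].
rewrite expr0 dvdp1 => /eqP sg.
by case: irr; rewrite sg.
Qed.

(** The leading coefficient of g' is nonzero because the degree of g is below p. *)
Lemma irreducible_ndvd_deriv g :
  irreducible_poly g -> (size g <= p)%N -> ~~ (g %| g^`()).
Proof.
case=> g1 _ le_p; have g0 : g != 0 by rewrite -size_poly_gt0 ltnW.
apply/negP => /dvdp_leq le_g.
have d0 : g^`() != 0.
  apply/eqP => /(congr1 (fun q : {poly F} => q`_(size g).-2)); rewrite coef_deriv coef0.
  rewrite prednK; last by case: (size g) g1 => [|[]].
  rewrite -/(lead_coef g) -mulr_natr => /eqP; rewrite mulf_eq0 lead_coef_eq0 (negPf g0).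
  by apply/negP/natFp_neq0; case: (size g) g1 le_p => [|[]].
by have := le_g d0; rewrite leqNgt lt_size_deriv.
Qed.

(** Let g be an irreducible factor of A of multiplicity m.  As A^e is a power of
    exponent p - 1 > e, it follows that m >= 2.  Write A = S g^m and P2 = T g^a, where
    a <= 1 because P2 is squarefree.  The lowest order term of (P2 A')' at g is
    m (m + a - 1) T S g'^2 g^(m+a-2), of order less than m, and it cannot be cancelled
    by P0 A; its coefficient is nonzero in F_p because m < p. *)
Lemma ode_no_root_power (A Q P2 P0 : {poly F}) e :
    A != 0 -> (size A <= p)%N -> (0 < e < p.-1)%N -> Q ^+ p.-1 = A ^+ e ->
    coprimep P2 P2^`() -> (P2 * A^`())^`() + P0 * A = 0 ->
  (size A <= 1)%N.
Proof.
move=> A0 size_A /andP[e0 lt_e] QA cop ode; rewrite leqNgt; apply/negP => A1.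
have [g irr gA] := exists_irreducible A1.
have [g1 _] := irr; have g0 : g != 0 by rewrite -size_poly_gt0 ltnW.
have le_g : (size g <= p)%N by rewrite (leq_trans _ size_A) // dvdp_leq.
have size_gX k : size (g ^+ k) = ((size g).-1 * k).+1.
  by rewrite -[LHS]prednK ?size_poly_gt0 ?expf_neq0 // size_exp.
have [m gmA maxm] : exists2 m, g ^+ m %| A & forall k, g ^+ k %| A -> (k <= m)%N.
  have ex0 : exists k, g ^+ k %| A by exists 0%N; rewrite expr0 dvd1p.
  have bnd k : g ^+ k %| A -> (k <= p)%N.
    move/dvdp_leq => /(_ A0) le; have := leq_trans le size_A; rewrite size_gX.
    by case: (size g) g1 => [|[|s]] // _ /=; nia.
  by case: (ex_maxnP ex0 bnd) => m; exists m.
have lt_mp : (m < p)%N.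
  have := leq_trans (dvdp_leq A0 gmA) size_A; rewrite size_gX.
  by case: (size g) g1 => [|[|s]] // _ /=; nia.
have m_gt0 : (0 < m)%N by apply: maxm; rewrite expr1.
have /dvdpP[S def_A] := gmA.
have gS : ~~ (g %| S).
  apply/negP => /dvdpP[S' def_S]; have := maxm m.+1.
  by rewrite def_A def_S exprS -mulrA dvdp_mull // ltnn => /(_ isT).
have m_gt1 : (1 < m)%N.
  rewrite ltnNge; apply: contra gS => m_le1; have m1 : m = 1%N by lia.
  have gQ : g %| Q.
    apply: (@irreducible_dvdp_exp _ _ p.-1) => //; rewrite QA.
    by rewrite (dvdp_trans gA) // -{1}[A]expr1 dvdp_exp2l.
  apply: (@irreducible_dvdp_exp _ _ e) => //.
  have : g ^+ e * g %| S ^+ e * g ^+ e.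
    rewrite -exprSr -exprMn; move: def_A; rewrite m1 expr1 => <-.
    by rewrite -QA (dvdp_trans (dvdp_exp2r _ gQ)) // dvdp_exp2l.
  by rewrite mulrC dvdp_mul2r // expf_neq0.
have [a [T [a1 def_P2 gT]]] : exists a T, [/\ (a <= 1)%N, P2 = T * g ^+ a & ~~ (g %| T)].
  case: (boolP (g %| P2)) => [gP|]; last by exists 0%N, P2; rewrite expr0 mulr1.
  have /dvdpP[T def_P2] := gP; exists 1%N, T; split=> //.
  apply/negP => /dvdpP[T' def_T].
  have gP' : g %| P2^`().
    rewrite def_P2 def_T derivM; apply: dvdp_add; first exact: dvdp_mull.
    by rewrite mulrAC dvdp_mull.
  have : g %| gcdp P2 P2^`() by rewrite dvdp_gcd gP gP'.
  move/dvdp_leq; rewrite -size_poly_gt0 (eqP cop) => /(_ isT).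
  by rewrite leqNgt g1.
have [k def_k] : exists k, (a + m = k.+2)%N by exists (a + m - 2)%N; lia.
have [b def_b] : exists b, (b.+1 + k = m)%N by exists (1 - a)%N; lia.
pose W := T * (S^`() * g + S * g^`() *+ m).
have PA' : P2 * A^`() = W * g ^+ k.+1.
  rewrite def_P2 def_A derivM deriv_exp /W.
  rewrite (_ : g ^+ m = g * g ^+ m.-1); last by rewrite -exprS prednK.
  have <- : g ^+ a * g ^+ m.-1 = g ^+ k.+1 by rewrite -exprD; congr (_ ^+ _); lia.
  ring.
have : g ^+ k * g %| g ^+ k * (g^`() * W *+ k.+1 + g * W^`()).
  have -> : g ^+ k * (g^`() * W *+ k.+1 + g * W^`()) = - (P0 * A).
    apply/eqP; rewrite -addr_eq0 -[X in _ == X]ode PA' (derivM W) (deriv_exp g) exprS /=.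
    by apply/eqP; congr (_ + _); ring.
  rewrite dvdpNr; apply/dvdpP; exists (P0 * S * g ^+ b).
  by rewrite {1}def_A -{1}def_b exprD exprS; ring.
rewrite dvdp_mul2l ?expf_neq0 // dvdp_addl ?dvdp_mulr //.
have g' := irreducible_ndvd_deriv irr le_g.
rewrite -scaler_nat dvdpZr ?natFp_neq0 //; last by lia.
move=> /(irreducible_dvdp_mul irr); rewrite (negPf g') /=.
move=> /(irreducible_dvdp_mul irr); rewrite (negPf gT) /=.
rewrite dvdp_addr ?dvdp_mull // -scaler_nat dvdpZr ?natFp_neq0 ?m_gt0 //.
by move=> /(irreducible_dvdp_mul irr); rewrite (negPf gS) (negPf g').
Qed.
End OdePoly.

(** * The contradiction modulo a large prime *)

Section ModPContradiction.
Variables (p : nat) (p_pr : prime p).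
Hypothesis p_gt7 : (7 < p)%N.
Local Notation F := 'F_p.
Local Notation A := (int_poly p bseq).

Lemma coef_int_poly s n : (int_poly p s)`_n = if (n < p)%N then (s n)%:~R else 0.
Proof. exact: coef_poly. Qed.

(** The recurrence at p reads 2 b(p+1) = 8 b(p) + 3 b(p-1), where Lucas gives b(p) = 4
    and b(p+1) = 16. *)
Lemma bseq_pred_eq0 : (bseq p.-1)%:~R = 0 :> F.
Proof.
have p0 : p%:R = 0 :> F by apply: pchar_Fp_0.
have bp : (bseq p)%:~R = 4 :> F.
  by have := @bseq_lucas p p_pr 0 1 (prime_gt0 p_pr); rewrite add0n muln1 bseq0 bseq1 mul1r.
have bp1 : (bseq p.+1)%:~R = 16 :> F.
  have := @bseq_lucas p p_pr 1 1 (prime_gt1 p_pr).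
  by rewrite add1n muln1 bseq1 -intrM.
have := bseq_rec p.-1; rewrite prednK ?prime_gt0 //.
move/(congr1 (fun z : int => z%:~R : F)).
move: (bseq p) (bseq p.+1) (bseq p.-1) bp bp1 => b0 b1 b2 E0 E1.
rewrite !(rmorph_nat, rmorph1, rmorphXn, intrB, intrM, intrD) /= E0 E1 -!pmulrn.
rewrite -[p.+1%:R]natr1 p0 => E.
have /eqP : 3 * (b2%:~R : F) = 0.
  transitivity (((29 * 0 ^+ 2 + 29 * 0 + 8) * 4 - 3 * (9 * 0 ^+ 2 - 1) * b2%:~R)
    - 2 * (0 + 1) ^+ 2 * 16 : F); first by ring.
  by rewrite -E subrr.
by rewrite mulf_eq0 (negPf (natFp_neq0 p_pr _)) ?(ltn_trans _ p_gt7) // => /eqP.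
Qed.

(** The recurrence survives the truncation below degree p: at m + 2 = p because of
    the factor (m + 2)^2, and at m + 1 = p because b(p-1) vanishes. *)
Lemma int_poly_bseq_rec m :
  2 * m.+2%:R ^+ 2 * A`_m.+2 =
  (29 * m.+1%:R ^+ 2 + 29 * m.+1%:R + 8) * A`_m.+1 - 3 * (9 * m.+1%:R ^+ 2 - 1) * A`_m.
Proof.
have p0 : p%:R = 0 :> F by apply: pchar_Fp_0.
have := bseq_rec m; move/(congr1 (fun z : int => z%:~R : F)).
rewrite !coef_int_poly; move: bseq_pred_eq0.
have [lt_m2|] := ltnP m.+2 p.
  rewrite (ltn_trans _ lt_m2) // (ltn_trans _ lt_m2) // => _.
  move: (bseq _) (bseq m.+1) (bseq m) => b0 b1 b2.
  by rewrite !(rmorph_nat, rmorph1, rmorphXn, intrB, intrM, intrD) /= -!pmulrn.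
rewrite leq_eqVlt => /predU1P[def_p _|].
  have [-> ->] : (m.+1 < p)%N /\ (m < p)%N by lia.
  rewrite -def_p; move: (bseq _) (bseq m.+1) (bseq m) => b0 b1 b2.
  rewrite !(rmorph_nat, rmorph1, rmorphXn, intrB, intrM, intrD) /= -!pmulrn p0 => <-.
  by rewrite expr0n /= !(mulr0, mul0r).
rewrite ltnS leq_eqVlt => /predU1P[def_p b0 _|].
  have [-> ->] : (m < p)%N /\ (m.+1 < p)%N = false by lia.
  by move: b0; rewrite def_p => ->; rewrite !mulr0 subrr.
move=> lt_p _ _.
have [-> ->] : (m < p)%N = false /\ (m.+1 < p)%N = false by lia.
by rewrite !mulr0 subrr.
Qed.

Definition bseq_ode2 : {poly F} := 27 *: 'X^3 - 29 *: 'X^2 + 2 *: 'X.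
Definition bseq_ode0 : {poly F} := 24 *: 'X - 8%:P.

(** The recurrence, rewritten as a self-adjoint differential equation. *)
Lemma int_poly_bseq_ode : (bseq_ode2 * A^`())^`() + bseq_ode0 * A = 0.
Proof.
have lt1 : (1 < p)%N := prime_gt1 p_pr.
have A0 : A`_0 = 1 by rewrite coef_int_poly ltnW // bseq0.
have A1 : A`_1 = 4 by rewrite coef_int_poly lt1 bseq1.
apply/polyP => n; rewrite coef0 coefD coef_deriv.
rewrite !mulrDl !mulNr -!scalerAl !coefD !coefN !coefZ !coefXnM !coefXM mul_polyC coefZ.
case: n => [|[|m]] /=.
- by rewrite !coef_deriv A0 A1; ring.
- have := int_poly_bseq_rec 0; rewrite !coef_deriv A0 A1 subnn mulr1n.
  by move/eqP; rewrite -subr_eq0 => /eqP E; rewrite -[RHS]E /=; ring.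
have := int_poly_bseq_rec m.+1.
rewrite !coef_deriv !subSS !subn0 -[A`_m.+1 *+ _]mulr_natr -[A`_m.+2 *+ _]mulr_natr.
rewrite -[A`_m.+3 *+ _]mulr_natr -[(_ + _) *+ _]mulr_natr.
rewrite -[m.+3%:R]natr1 -[m.+2%:R]natr1.
by move/eqP; rewrite -subr_eq0 => /eqP E; rewrite -[RHS]E; ring.
Qed.

Lemma coprimep_bezout (P Q u v : {poly F}) (c : F) :
  c != 0 -> u * P + v * Q = c%:P -> coprimep P Q.
Proof.
move=> c0 E; apply/Bezout_coprimepP; exists (u, v).
by rewrite /= E -size_poly_eq1 size_polyC c0.
Qed.

(** The linear factors of P2 are pairwise coprime as p does not divide 10; the Bezout
    relations come from dividing P2' by each of them. *)
Lemma bseq_ode2_coprime : coprimep bseq_ode2 bseq_ode2^`().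
Proof.
have dP : bseq_ode2^`() = 81 *: 'X^2 - 58 *: 'X + 2%:P.
  rewrite /bseq_ode2 derivD derivB !derivZ !derivXn derivX /=.
  by rewrite -!scaler_nat !scalerA expr1 -!natrM alg_polyC.
have fact : bseq_ode2 = 'X * ('X - 1) * (27 *: 'X - 2%:P).
  by rewrite /bseq_ode2 -!mul_polyC; ring.
rewrite dP fact !coprimepMl -andbA; apply/and3P; split.
- apply: (@coprimep_bezout _ _ (- (81 *: 'X - 58%:P)) 1 2).
    by rewrite natFp_neq0 // (ltn_trans _ p_gt7).
  by rewrite -!mul_polyC; ring.
- apply: (@coprimep_bezout _ _ (- (81 *: 'X + 23%:P)) 1 (5 * 5)).
    by rewrite mulf_neq0 // natFp_neq0 // (ltn_trans _ p_gt7).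
  by rewrite -!mul_polyC; ring.
apply: (@coprimep_bezout _ _ (81 *: 'X - 52%:P) (- 27%:P) (2 * (5 * 5))).
  by rewrite !mulf_neq0 // natFp_neq0 // (ltn_trans _ p_gt7).
by rewrite -!mul_polyC; ring.
Qed.

(** From l G^e = m and A^p G^(p-1) = A1^(p-1) it follows that A^(p e), hence A^e, is a
    (p-1)-st power, to which [ode_no_root_power] applies. *)
Lemma modp_contradiction (P : {poly {poly F}}) : P != 0 -> (size P < p)%N ->
  (map_poly (@poly_laurent F) P).[fps_laurent (int_fps F gseq)] <> 0.
Proof.
move=> P0 lt_P Pg; have lt1 : (1 < p)%N := prime_gt1 p_pr.
have A0 : A != 0.
  apply/eqP => /(congr1 (fun q : {poly F} => q`_0)) /eqP.
  by rewrite coef_int_poly coef0 ltnW // bseq0 oner_eq0.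
have G0 : int_poly p gseq != 0.
  (* The coefficient of z^2 in G is 336 = 2^4 * 3 * 7. *)
  apply/eqP => /(congr1 (fun q : {poly F} => q`_2)) /eqP.
  rewrite coef_int_poly coef0 (leq_trans _ p_gt7) // gseq2.
  rewrite (_ : 336 = (2 ^ 4 * 3 * 7)%N%:Z) // -pmulrn !natrM.
  by rewrite !mulf_eq0 !(negPf (natFp_neq0 p_pr _)) //; lia.
have UgV : poly_laurent (A ^+ p) * fps_laurent (int_fps F gseq) ^+ p.-1
    = poly_laurent (int_poly p gseq ^+ p.-1).
  rewrite /poly_laurent -(gseq_poly_exp p_pr) [RHS]rmorphM; congr (_ * _).
  by rewrite rmorphXn.
have [||e [l [m [/andP[e0 lt_e] l0 m0 lgm]]]] := kummer p_pr _ _ UgV P0 Pg.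
- exact: expf_neq0.
- exact: expf_neq0.
have lt_ep : (e < p.-1)%N by lia.
set g := fps_laurent _ in UgV lgm.
have E1 : (l * int_poly p gseq ^+ e) ^+ p.-1 = m ^+ p.-1 * (A ^+ (p * e)).
  apply: poly_laurent_inj; rewrite !(rmorphM, rmorphXn) /= -lgm !exprMn -!mulrA.
  congr (_ * _); move: UgV; rewrite !rmorphXn /= => UgV.
  by rewrite -exprM mulnC exprM -UgV exprMn -!exprM [(p.-1 * e)%N]mulnC mulrC.
have /dvdpP[R def_R] : m %| l * int_poly p gseq ^+ e.
  by rewrite -(@dvdp_pexp2r _ _ _ p.-1) ?E1 ?dvdp_mulr //; lia.
(* p e = e + e (p - 1), so the (p-1)-st power of A^e can be divided out. *)
have E2 : R ^+ p.-1 = A ^+ e * (A ^+ e) ^+ p.-1.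
  have mp0 : m ^+ p.-1 != 0 by apply: expf_neq0.
  apply: (mulIf mp0); rewrite -exprMn -def_R E1 mulrC -exprS prednK; last by lia.
  by rewrite -exprM mulnC.
have /dvdpP[Q def_Q] : A ^+ e %| R.
  by rewrite -(@dvdp_pexp2r _ _ _ p.-1) ?E2 ?dvdp_mull //; lia.
have QA : Q ^+ p.-1 = A ^+ e.
  have Ap0 : (A ^+ e) ^+ p.-1 != 0 by rewrite !expf_neq0.
  by apply: (mulIf Ap0); rewrite -E2 def_Q exprMn.
have := ode_no_root_power p_pr A0 (size_poly _ _) _ QA bseq_ode2_coprime int_poly_bseq_ode.
rewrite e0 lt_ep => /(_ isT) /size1_polyC def_A.
have /eqP : A`_1 = 0 by rewrite def_A coefC.
rewrite coef_int_poly lt1 bseq1 -[4%:~R]/(4%:R).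
by rewrite (negPf (natFp_neq0 p_pr _)) //; lia.
Qed.

End ModPContradiction.

(** * Reducing an algebraic relation modulo a prime *)

Section Transfer.
Variables (s : nat -> int) (h d : nat).

Definition int_trunc (n : nat) : {poly int} := \poly_(k < n) s k.

(** The coefficient of z^n in z^i G^j, where G has coefficients s. *)
Definition monomial_coef (i j n : nat) : int := ('X^i * int_trunc n.+1 ^+ j)`_n.

Definition monomial_mx (N : nat) : 'M[int]_(h * d, N) :=
  \matrix_(k, n) mxvec (\matrix_(i < h, j < d) monomial_coef i j n) 0 k.

(** The polynomial in z and Y with coefficient c i j at z^i Y^j. *)
Definition mx_poly (K : fieldType) (c : 'M[K]_(h, d)) : {poly {poly K}} :=
  \sum_(i < h) \sum_(j < d) (c i j *: 'X^i) *: 'X^j.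

Lemma coef_mx_poly (K : fieldType) (c : 'M[K]_(h, d)) (i : 'I_h) (j : 'I_d) :
  (mx_poly c)`_j`_i = c i j.
Proof.
rewrite /mx_poly coef_sum coef_sum (bigD1 i) //= coef_sum coef_sum (bigD1 j) //=.
rewrite coefZ coefXn eqxx mulr1 coefZ coefXn eqxx mulr1.
rewrite big1 ?addr0 => [|j' ne_j]; last first.
  by rewrite coefZ coefXn eq_sym -val_eqE in ne_j *; rewrite (negPf ne_j) mulr0 coef0.
rewrite big1 ?addr0 // => i' ne_i.
rewrite coef_sum coef_sum big1 // => j' _.
rewrite coefZ coefXn; case: eqP => _; rewrite ?mulr0 ?coef0 // mulr1.
by rewrite coefZ coefXn -val_eqE eq_sym in ne_i *; rewrite (negPf ne_i) mulr0.
Qed.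

Lemma size_mx_poly (K : fieldType) (c : 'M[K]_(h, d)) : (size (mx_poly c) <= d)%N.
Proof.
apply: (leq_trans (size_sum _ _ _)); apply/bigmax_leqP => i _.
apply: (leq_trans (size_sum _ _ _)); apply/bigmax_leqP => j _.
by rewrite (leq_trans (size_scale_leq _ _)) // size_polyXn.
Qed.

Lemma mx_polyP (K : fieldType) (P : {poly {poly K}}) :
    (size P <= d)%N -> (forall j, (size (P`_j)%R <= h)%N) ->
  exists c : 'M[K]_(h, d), P = mx_poly c.
Proof.
move=> sP sPj; exists (\matrix_(i, j) P`_j`_i); apply/polyP => j; apply/polyP => i.
have [lt_j|le_j] := ltnP j d; last first.
  rewrite (nth_default _ (leq_trans sP le_j)).
  by rewrite (nth_default _ (leq_trans (size_mx_poly _) le_j)).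
have [lt_i|le_i] := ltnP i h; last first.
  rewrite (nth_default _ (leq_trans (sPj j) le_i)) /mx_poly.
  rewrite coef_sum coef_sum big1 // => i' _; rewrite coef_sum coef_sum big1 // => j' _.
  rewrite coefZ coefXn; case: eqP => _; rewrite ?mulr0 ?coef0 // mulr1.
  by rewrite coefZ coefXn gtn_eqF ?mulr0 // (leq_trans (ltn_ord i')).
by rewrite (@coef_mx_poly _ _ (Ordinal lt_i) (Ordinal lt_j)) mxE.
Qed.

Lemma monomial_coefE (K : fieldType) (i j n : nat) :
  (poly_fps 'X^i * int_fps K s ^+ j) n = (monomial_coef i j n)%:~R.
Proof.
rewrite (@fps_mul_coef K _ _ 'X^i (fps_trunc n.+1 (int_fps K s) ^+ j)) //; last first.
  by move=> k le_kn; rewrite (@fps_exp_trunc _ _ n.+1).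
rewrite /monomial_coef -(coef_map intr) rmorphM !rmorphXn /= map_polyX.
congr (('X^i * _ ^+ j)`_n); apply/polyP => k.
by rewrite coef_map /= !coef_poly; case: ifP; rewrite ?rmorph0.
Qed.

Lemma fps_scale_coef (K : fieldType) (a : K) (f : fps K) n :
  (poly_fps a%:P * f) n = a * f n.
Proof.
rewrite /= big_ord_recl /= coefC /= subn0 big1 ?addr0 // => k _.
by rewrite coefC mul0r.
Qed.

Lemma horner_mx_poly (K : fieldType) (c : 'M[K]_(h, d)) N (n : 'I_N) :
  (map_poly (@poly_fps K) (mx_poly c)).[int_fps K s] n
    = (mxvec c *m map_mx intr (monomial_mx N)) 0 n.
Proof.
rewrite mxE (reindex _ (curry_mxvec_bij _ _)) /=.
pose f i j := mxvec c 0 (mxvec_index i j) *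
    map_mx intr (monomial_mx N) (mxvec_index i j) n.
rewrite [RHS](eq_bigr (fun q => f q.1 q.2)) => [|[i j] _ //].
rewrite -(pair_bigA _ f) /f /=.
rewrite /mx_poly rmorph_sum /= horner_sum.
have coef_sum_fps I (r : seq I) (u : I -> fps K) :
    (\sum_(k <- r) u k) n = \sum_(k <- r) u k n.
  by elim/big_rec2: _ => // k v w _ <-.
rewrite coef_sum_fps; apply: eq_bigr => i _.
rewrite rmorph_sum /= horner_sum coef_sum_fps; apply: eq_bigr => j _.
have -> : (map_poly (@poly_fps K) ((c i j *: 'X^i) *: 'X^j)).[int_fps K s]
    = poly_fps (c i j)%:P * (poly_fps 'X^i * int_fps K s ^+ j).
  by rewrite map_polyZ map_polyXn hornerZ hornerXn -mul_polyC rmorphM mulrA.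
rewrite fps_scale_coef monomial_coefE.
by rewrite mxvecE !mxE mxvecE mxE.
Qed.

(** If the rows were independent modulo p, some maximal minor would be nonzero modulo p,
    hence a nonzero integer, hence nonzero in K. *)
Lemma row_free_intr (K : fieldType) (p : nat) N :
    [pchar K] =i pred0 -> prime p ->
  ~~ row_free (map_mx intr (monomial_mx N) : 'M[K]_(_, _)) ->
  ~~ row_free (map_mx intr (monomial_mx N) : 'M['F_p]_(_, _)).
Proof.
move=> charK p_pr; apply: contra.
have trE (L : fieldType) : row_free (map_mx intr (monomial_mx N) : 'M[L]_(_, _))
    = row_full (map_mx intr (monomial_mx N)^T : 'M[L]_(_, _)).
  by rewrite -row_leq_rank -col_leq_rank -map_trmx mxrank_tr.
rewrite !trE; move: (monomial_mx N)^T => M full.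
have := fullrowsub_unit full; rewrite -map_mxsub /= unitmxE det_map_mx unitfE => det_p.
rewrite -sub1mx.
have : rowsub (fullrankfun full) (map_mx intr M : 'M[K]_(_, _)) \in unitmx.
  rewrite -map_mxsub unitmxE det_map_mx unitfE; apply: contraNneq det_p.
  move: (\det _) => z z0; suff -> : z = 0 by [].
  move: z z0 => [n|n]; rewrite ?NegzE ?rmorphN /= -?pmulrn => /eqP.
    by rewrite (proj1 (pcharf0P K) charK) => /eqP->.
  by rewrite oppr_eq0 (proj1 (pcharf0P K) charK).
rewrite -row_full_unit -sub1mx => /submx_trans; apply.
exact: rowsub_sub.
Qed.

End Transfer.

(** Modulo p there is, for each N, a nonzero combination of the z^i G^j that vanishes
    up to order N.  As there are only finitely many combinations, one of them
    works for all N. *)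
Lemma transfer_modp (K : fieldType) (s : nat -> int) (P : {poly {poly K}}) (p : nat) :
    [pchar K] =i pred0 -> P != 0 -> (map_poly (@poly_fps K) P).[int_fps K s] = 0 ->
    prime p ->
  exists Q : {poly {poly 'F_p}}, [/\ Q != 0, (size Q <= size P)%N
    & (map_poly (@poly_fps 'F_p) Q).[int_fps 'F_p s] = 0].
Proof.
move=> charK P0 Ps p_pr; set d := size P.
pose h := (\max_(j < d) size (P`_j)%R)%N.
have [c def_P] : exists c : 'M[K]_(h, d), P = mx_poly c.
  apply: mx_polyP => // j; have [lt_j|le_j] := ltnP j d.
    exact: (leq_bigmax (Ordinal lt_j)).
  by rewrite nth_default // size_poly0.
have c0 : mxvec c != 0.
  apply: contraNneq P0 => /(canRL mxvecK); rewrite linear0 def_P => ->.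
  by rewrite /mx_poly big1 // => i _; rewrite big1 // => j _; rewrite mxE !scale0r.
have ker N : exists2 u : 'M['F_p]_(h, d),
    u != 0 & mxvec u *m map_mx intr (monomial_mx s h d N) = 0.
  have : ~~ row_free (map_mx intr (monomial_mx s h d N) : 'M[K]_(_, _)).
    apply: contra c0 => free; rewrite -(mulmx_free_eq0 _ free); apply/eqP/rowP => n.
    by rewrite -horner_mx_poly -def_P Ps !mxE.
  move/(row_free_intr charK p_pr); rewrite -kermx_eq0 => /rowV0Pn[u /sub_kermxP uM u0].
  by exists (vec_mx u); rewrite ?vec_mxK // -(inj_eq (can_inj mxvecK)) vec_mxK linear0.
apply: boolp.contrapT => nex.
have witness (u : 'M['F_p]_(h, d)) : exists N, u != 0 ->
    exists n : 'I_N, (map_poly (@poly_fps 'F_p) (mx_poly u)).[int_fps 'F_p s] n != 0.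
  have [u0|u0] := eqVneq u 0; first by exists 0%N.
  apply: boolp.contrapT => nN; apply: nex; exists (mx_poly u); split.
  - apply: contraNneq u0 => u0; apply/eqP/matrixP => i j.
    by rewrite -coef_mx_poly u0 !coef0 mxE.
  - exact: size_mx_poly.
  apply: fpsP => n; apply: boolp.contrapT => un; apply: nN; exists n.+1 => _.
  by exists ord_max; apply/eqP.
have [N HN] := boolp.choice witness.
have [u u0 uM] := ker (\max_u N u)%N.
have [n /eqP] := HN u u0; apply.
have lt_n : (n < \max_u N u)%N by apply: leq_trans (ltn_ord n) (leq_bigmax u).
by rewrite -[nat_of_ord n]/(nat_of_ord (Ordinal lt_n)) horner_mx_poly uM mxE.
Qed.

Lemma scale_common_denominator (L : fieldType) (a d q : L) (r : {poly L}) :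
  d != 0 -> d *: (q *: r * 'X) + q%:P * a%:P = (q * d) *: (r * 'X + (a / d)%:P).
Proof.
move=> d0; rewrite scalerDr -scalerAl scalerA [d * q]mulrC; congr (_ + _).
by rewrite -mul_polyC -!polyCM -mulrA [d * _]mulrC divfK.
Qed.

(** * Algebraic power series and derivation *)

Section Algebraic.
Variable K : fieldType.
Implicit Types (f g : fps K) (P : {poly {poly K}}) (q : {poly K}).
Local Notation alg := (algebraicOver (@ratfun_laurent K)).

Lemma horner_laurent P f :
  (map_poly (@poly_laurent K) P).[fps_laurent f]
    = fps_laurent (map_poly (@poly_fps K) P).[f].
Proof.
rewrite -horner_map /= -map_poly_comp //.
Qed.

Lemma ratfun_laurent_poly q :
  ratfun_laurent (FracField.tofrac q : ratfun K) = poly_laurent q.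
Proof.
have := ratfun_laurentE q (oner_neq0 {poly K}).
by rewrite rmorph1 divr1 => ->; rewrite !rmorph1 divr1.
Qed.

Lemma clear_denominators (r : {poly ratfun K}) :
  exists (q : {poly K}) P, q != 0 /\
    map_poly (@FracField.tofrac _ : {poly K} -> ratfun K) P
      = (FracField.tofrac q : ratfun K) *: r.
Proof.
elim/poly_ind: r => [|r c [q [P [q0 IH]]]].
  by exists 1, 0; rewrite oner_neq0 scaler0 rmorph0.
have [a [d [d0 def_c]]] : exists a d : {poly K}, d != 0 /\
    c = (FracField.tofrac a : ratfun K) / FracField.tofrac d.
  by eexists; eexists; split; last exact: ratfun_numden; apply: denom_ratioP.
exists (q * d), (d *: (P * 'X) + (q * a)%:P); split; first by rewrite mulf_neq0.
have fd0 : (FracField.tofrac d : ratfun K) != 0 by rewrite tofrac_eq0.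
rewrite rmorphD /= map_polyZ rmorphM /= map_polyX IH map_polyC /= !rmorphM /= def_c.
exact: scale_common_denominator.
Qed.

Lemma algebraic_poly_relation f : alg (fps_laurent f) ->
  exists2 P, P != 0 & (map_poly (@poly_fps K) P).[f] = 0.
Proof.
case=> r r0 rf; have [q [P [q0 PE]]] := clear_denominators r.
exists P.
  apply: contraNneq r0 => P0; move/eqP: PE; rewrite P0 rmorph0 eq_sym scaler_eq0.
  by rewrite tofrac_eq0 (negPf q0).
apply: fps_laurent_inj; rewrite -horner_laurent rmorph0.
have -> : map_poly (@poly_laurent K) P = map_poly (@ratfun_laurent K)
    (map_poly (@FracField.tofrac _ : {poly K} -> ratfun K) P).
  by rewrite -map_poly_comp //; apply: eq_map_poly => y /=; rewrite ratfun_laurent_poly.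
by rewrite PE map_polyZ hornerZ (eqP rf) mulr0.
Qed.

Lemma algebraic_poly q : alg (poly_laurent q).
Proof. by rewrite -ratfun_laurent_poly; apply: algebraic_id. Qed.

Lemma algebraic_fpsD f g :
  alg (fps_laurent f) -> alg (fps_laurent g) -> alg (fps_laurent (f + g)).
Proof. by move=> af ag; rewrite rmorphD; exact: algebraic_add af ag. Qed.

Lemma algebraic_fpsN f : alg (fps_laurent f) -> alg (fps_laurent (- f)).
Proof. by move=> af; rewrite rmorphN; exact: algebraic_opp af. Qed.

Lemma algebraic_fpsM f g :
  alg (fps_laurent f) -> alg (fps_laurent g) -> alg (fps_laurent (f * g)).
Proof. by move=> af ag; rewrite rmorphM; exact: algebraic_mul af ag. Qed.

Lemma algebraic_horner P f :
  alg (fps_laurent f) -> alg (fps_laurent (map_poly (@poly_fps K) P).[f]).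
Proof.
move=> alg_f; elim/poly_ind: P => [|P c IH].
  by rewrite rmorph0 horner0 -(rmorph0 (@poly_fps K)); apply: algebraic_poly.
rewrite rmorphD rmorphM /= map_polyX map_polyC hornerMXaddC.
exact: algebraic_fpsD (algebraic_fpsM IH alg_f) (algebraic_poly c).
Qed.

(** The derivation z d/dz. *)
Definition fps_theta f : fps K := Fps (fun n => f n *+ n).

Lemma fps_thetaM f g : fps_theta (f * g) = fps_theta f * g + f * fps_theta g.
Proof.
apply: fpsP => n /=; rewrite -sumrMnl -big_split; apply: eq_bigr => i _ /=.
rewrite mulrnAl mulrnAr -mulrnDr subnKC //.
by rewrite -ltnS.
Qed.

Lemma fps_thetaD f g : fps_theta (f + g) = fps_theta f + fps_theta g.
Proof. by apply: fpsP => n /=; rewrite mulrnDl. Qed.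

Lemma fps_theta_poly q : fps_theta (poly_fps q) = poly_fps ('X * q^`()).
Proof. by apply: fpsP => -[|n] /=; rewrite coefXM // coef_deriv. Qed.

(** The chain rule, where Q arises by differentiating the coefficients of P. *)
Lemma fps_theta_horner P : exists Q : {poly {poly K}}, forall f,
  fps_theta (map_poly (@poly_fps K) P).[f] =
    (map_poly (@poly_fps K) Q).[f] + (map_poly (@poly_fps K) P^`()).[f] * fps_theta f.
Proof.
elim/poly_ind: P => [|P c [Q IH]].
  exists 0 => f; rewrite deriv0 !rmorph0 !horner0 mul0r addr0.
  by apply: fpsP => n /=; rewrite mul0rn.
exists (Q * 'X + ('X * c^`())%:P) => f.
rewrite derivD derivC addr0 derivM derivX mulr1.
rewrite !(rmorphD, rmorphM) /= !map_polyX !map_polyC /= !hornerE.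
by rewrite fps_thetaD fps_thetaM IH fps_theta_poly; ring.
Qed.

(** Differentiating a relation P(f) = 0 of minimal degree expresses the derivative of f
    as a quotient of polynomials in f, whose denominator P'(f) is nonzero by
    minimality. *)
Lemma algebraic_theta f : [pchar K] =i pred0 ->
  alg (fps_laurent f) -> alg (fps_laurent (fps_theta f)).
Proof.
move=> charK alg_f; have [P] := algebraic_poly_relation alg_f.
move: {2}(size P) (leqnn (size P)) => n.
elim: n P => [|n IHn] P le_n P0 Pf.
  by exfalso; move: P0; rewrite -size_poly_leq0 le_n.
have P1 : (1 < size P)%N.
  rewrite ltnNge; apply: contra P0 => le1; move: Pf; rewrite (size1_polyC le1).
  rewrite map_polyC hornerC /= -(rmorph0 (@poly_fps K)) => /poly_fps_inj ->.
  by rewrite polyC0.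
have dP0 : P^`() != 0.
  apply/eqP => /(congr1 (fun Q : {poly {poly K}} => Q`_(size P).-2)).
  rewrite coef_deriv coef0 prednK; last by case: (size P) P1 => [|[]].
  rewrite -/(lead_coef P) -scaler_nat => /eqP.
  rewrite scaler_eq0 lead_coef_eq0 (negPf P0) orbF.
  rewrite (proj1 (pcharf0P K) charK).
  by case: (size P) P1 => [|[]].
have [dPf|dPf] := eqVneq (map_poly (@poly_fps K) P^`()).[f] 0.
  by apply: (IHn P^`()) => //; rewrite -ltnS (leq_trans (lt_size_deriv P0)).
have [Q QE] := fps_theta_horner P.
have := QE f; rewrite Pf => /(congr1 (@fps_laurent K)).
have -> : fps_theta 0 = 0 :> fps K by apply: fpsP => k /=; rewrite mul0rn.
rewrite rmorph0 rmorphD rmorphM /= => /esym/eqP; rewrite addrC addr_eq0 => /eqP E.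
have dPf0 : fps_laurent (map_poly (@poly_fps K) P^`()).[f] != 0 by rewrite fps_laurent_eq0.
rewrite -(mulKf dPf0 (fps_laurent (fps_theta f))) E.
apply: algebraic_mul; first by apply/algebraic_inv/algebraic_horner.
by apply/algebraic_opp/algebraic_horner.
Qed.

End Algebraic.

(** The factors n, 3 n + 1 and n - 1 of g(n) correspond to successive uses of the
    derivation. *)
Lemma gseq_theta (K : fieldType) : let f := genfun K (fun n => #|words123 n|) in
  let f1 := fps_theta f in let f2 := poly_fps 3%:P * fps_theta f1 + f1 in
  int_fps K gseq = poly_fps 6%:P * (fps_theta f2 - f2).
Proof.
move=> f f1 f2; apply: fpsP => n; rewrite fps_scale_coef.
rewrite -[fps_coef (fps_theta f2 - f2) n]/(f2 n *+ n - f2 n).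
have -> : f2 n = 3 * (f n *+ n *+ n) + f n *+ n.
  by rewrite -[f2 n]/((poly_fps 3%:P * fps_theta f1) n + f1 n) fps_scale_coef.
rewrite -[f n]/(#|words123 n|%:R) -[int_fps K gseq n]/((gseq n)%:~R) /gseq /count123.
move: #|_| => w.
rewrite !intrM rmorph_nat intrB [(_ + 1)%:~R]intrD intrM rmorph_nat -!pmulrn.
rewrite -[w%:R *+ n *+ n]mulr_natr -[w%:R *+ n]mulr_natr -[(_ + _) *+ n]mulr_natr.
by ring.
Qed.

Theorem mainTheorem4 (K : fieldType) (charK0 : [pchar K]%R =i pred0) :
  transcendental_fps (genfun K (fun n => #|words123 n|)).
Proof.
move=> alg_F.
have alg_G : algebraicOver (@ratfun_laurent K) (fps_laurent (int_fps K gseq)).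
  pose f := genfun K (fun n => #|words123 n|).
  have a1 : algebraicOver (@ratfun_laurent K) (fps_laurent (fps_theta f)).
    exact: algebraic_theta.
  have a2 := algebraic_fpsD (algebraic_fpsM (algebraic_poly 3%:P)
    (algebraic_theta charK0 a1)) a1.
  have a3 := algebraic_fpsD (algebraic_theta charK0 a2) (algebraic_fpsN a2).
  rewrite gseq_theta; exact: algebraic_fpsM (algebraic_poly 6%:P) a3.
have [P P0 PG] := algebraic_poly_relation alg_G.
have [p] := prime_above (maxn 7 (size P)); rewrite gtn_max => /andP[p_gt7 lt_P] p_pr.
have [Q [Q0 le_Q QG]] := transfer_modp charK0 P0 PG p_pr.
apply: (modp_contradiction p_pr p_gt7 Q0 (leq_ltn_trans le_Q lt_P)).
by rewrite horner_laurent QG rmorph0.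
Qed.
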